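(* Let $T$ be a triangulation of the $n$-gon. For each quadrilateral weight map $w_T:\mathbb R^{2n-3}\to\mathbb R$ for $T$, the initial ideal $\operatorname{in}_{\mathbf w_T}(I_{2,n})$ is toric, i.e. binomial and prime. Moreover, every binomial in the minimal generating set of $\operatorname{in}_{\mathbf w_T}(I_{2,n})$ corresponds to a quadrilateral and it contains the monomial associated to the crossing in that quadrilateral.
   Context: The vertices of an $n$-gon are labelled clockwise by the cyclically ordered set $[n]=\{1,\dots,n\}$; ''$i<j<k<l$'' means these vertices occur in this clockwise cyclic order. $S=\mathbb C[p_{ij}:1\le i<j\le n]$, $p_{ji}=-p_{ij}$, $R_{ijkl}=p_{ij}p_{kl}-p_{ik}p_{jl}+p_{il}p_{jk}$, and $I_{2,n}\subset S$ is the ideal generated by all $R_{ijkl}$ with $i<j<k<l$. For a weight vector $w\in\mathbb R^{\binom n2}$, $\operatorname{in}_w(f)$ is the sum of the terms of $f$ of minimal $w$-weight and $\operatorname{in}_w(I)=\langle\operatorname{in}_w(f):f\in I\rangle$. In a quadrilateral with vertices $i<j<k<l$ inside the $n$-gon, the arcs $\overline{ik}$ and $\overline{jl}$ cross; the monomial associated to the crossing in this quadrilateral is $p_{ik}p_{jl}$. A triangulation $T$ is a maximal set of pairwise non-crossing arcs, including the $n$ boundary edges; $|T|=2n-3$. Let $\hat T$ be the triangulation of the $2n$-gon with vertices $1',1,2',2,\dots,n',n$ (clockwise) obtained by gluing to each boundary edge $\overline{i-1,i}$ a triangle with new vertex $i'$. $\hat D_T$ is its planar dual tree: interior vertices are triangles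 of $\hat T$, interior edges $e_{ab}$ correspond to arcs $\overline{ab}\in T$, leaves correspond to boundary edges of the $2n$-gon; leaf $i'$ is the edge $\overline{i-1,i'}$ and leaf $i$ is the edge $\overline{i',i}$. Along the path from leaf $i$ to leaf $j$ put $\sigma^{ab}_{i\rightsquigarrow j}=+1$ if it passes through $e_{ab}$ turning left at the first endpoint of $e_{ab}$ and right at the second, $-1$ if it turns right at the first and left at the second, and $0$ otherwise. With $\{f_{ab}\}_{\overline{ab}\in T}$ the standard basis of $\mathbb Z^{2n-3}$ (where $f_{ab}=f_{ba}$), set $\mathbf g_{ij}=\sum_{\overline{ab}\in T}\sigma^{ab}_{i\rightsquigarrow j}f_{ab}$. A quadrilateral weight map for $T$ is a linear map $w_T:\mathbb R^{2n-3}\to\mathbb R$ with $w_T(f_{ad}+f_{bc})>w_T(f_{ab}+f_{cd})$ for every quadrilateral $a<b<c<d$ with $\overline{ab},\overline{bc},\overline{cd},\overline{ad}\in T$ and diagonal $\overline{ac}\in T$. The weight vector $\mathbf w_T\in\mathbb R^{\binom n2}$ associated to $T$ and $w_T$ is given by $(\mathbf w_T)_{ij}=w_T(\mathbf g_{ij})$. *)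

(* Defs.v *)
From HB Require Import structures.
From mathcomp Require Import all_boot all_order all_algebra.
From mathcomp Require Import boolp classical_sets reals.
From mathcomp Require Import complex mpoly.

Set Implicit Arguments.
Unset Strict Implicit.
Unset Printing Implicit Defensive.

Import Order.TTheory GRing.Theory Num.Theory.
Local Open Scope ring_scope.

(** * Polygons, arcs and triangulations *)

(* The vertices of an m-gon are 'I_m, in clockwise cyclic order. *)
Definition cw3 (m : nat) (a b c : 'I_m) : bool :=
  [|| (a < b < c)%N, (b < c < a)%N | (c < a < b)%N].

Definition cw4 (m : nat) (a b c d : 'I_m) : bool :=
  [|| [&& (a < b)%N, (b < c)%N & (c < d)%N],
      [&& (b < c)%N, (c < d)%N & (d < a)%N],
      [&& (c < d)%N, (d < a)%N & (a < b)%N] |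
      [&& (d < a)%N, (a < b)%N & (b < c)%N]].

(* An arc is the two-element set of its end points; boundary edges are arcs. *)
Definition crossing (m : nat) (e e' : {set 'I_m}) : bool :=
  [exists i, exists j, exists k, exists l,
    [&& cw4 i j k l, e == [set i; k]%SET & e' == [set j; l]%SET]].

Definition noncrossing_arcs (m : nat) (A : {set {set 'I_m}}) : bool :=
  [forall e in A, #|e| == 2%N] &&
  [forall e in A, forall e' in A, ~~ crossing e e'].

Definition triangulation (m : nat) (A : {set {set 'I_m}}) : bool :=
  maxset (@noncrossing_arcs m) A.

(** * The planar dual tree of a triangulation *)

(* As the vertices are in convex position, any three of them that are pairwise
   joined by arcs of U span a triangle of U. *)
Definition triangles (m : nat) (U : {set {set 'I_m}}) : {set {set 'I_m}} :=
  [set t : {set 'I_m} | (#|t| == 3%N) &&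
    [forall e : {set 'I_m}, (e \subset t) && (#|e| == 2%N) ==> (e \in U)]]%SET.

Definition boundary (m : nat) : {set {set 'I_m}} :=
  [set [set v; ordS v] | v : 'I_m]%SET.

(* The nodes are the triangles (interior vertices) and the boundary edges
   (leaves).  Two triangles are adjacent when they share an arc, a leaf and a
   triangle when the former is a side of the latter: in both cases the
   intersection has two elements, and two distinct leaves never do. *)
Definition dual_adj (m : nat) (U : {set {set 'I_m}}) : rel {set 'I_m} :=
  fun x y => [&& x \in triangles U :|: boundary m,
                 y \in triangles U :|: boundary m,
                 x != y & #|x :&: y| == 2%N].

Definition dual_path (m : nat) (U : {set {set 'I_m}}) (x y : {set 'I_m})
    (s : seq {set 'I_m}) : bool :=
  [&& path (dual_adj U) x s, last x s == y & uniq (x :: s)].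

(* Coming from x, the path crosses the side x :&: t of the triangle t and leaves
   through the side t :&: y.  If u, v, w are the vertices of t in clockwise
   order, then for somebody entering through uv the vertex v is on the left and
   u on the right, so that leaving through vw is a left turn and leaving
   through wu is a right turn. *)
Definition turns_left (m : nat) (x t y : {set 'I_m}) : bool :=
  [exists u, exists v, exists w,
    [&& cw3 u v w, t == [set u; v; w]%SET,
        x :&: t == [set u; v]%SET & t :&: y == [set v; w]%SET]].

Definition turns_right (m : nat) (x t y : {set 'I_m}) : bool :=
  [exists u, exists v, exists w,
    [&& cw3 u v w, t == [set u; v; w]%SET,
        x :&: t == [set u; v]%SET & t :&: y == [set w; u]%SET]].

(** * The extended triangulation of the 2n-gon *)

(* The clockwise vertices 1', 1, 2', 2, ..., n', n are numbered from 0. *)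
Fact old_vertex_subproof (n : nat) (i : 'I_n) : (i.*2.+1 < n.*2)%N.
Proof. by rewrite ltn_Sdouble. Qed.

Fact new_vertex_subproof (n : nat) (i : 'I_n) : (i.*2 < n.*2)%N.
Proof. by rewrite ltn_double. Qed.

Definition old_vertex (n : nat) (i : 'I_n) : 'I_(n.*2) :=
  Ordinal (old_vertex_subproof i).

Definition new_vertex (n : nat) (i : 'I_n) : 'I_(n.*2) :=
  Ordinal (new_vertex_subproof i).

Definition leaf (n : nat) (i : 'I_n) : {set 'I_(n.*2)} :=
  [set new_vertex i; old_vertex i]%SET.

Definition leaf' (n : nat) (i : 'I_n) : {set 'I_(n.*2)} :=
  [set old_vertex (ord_pred i); new_vertex i]%SET.

Definition old_arc (n : nat) (e : {set 'I_n}) : {set 'I_(n.*2)} :=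
  (@old_vertex n @: e)%SET.

Definition hat (n : nat) (T : {set {set 'I_n}}) : {set {set 'I_(n.*2)}} :=
  [set old_arc e | e in T]%SET
    :|: [set leaf' i | i : 'I_n]%SET :|: [set leaf i | i : 'I_n]%SET.

(** * g-vectors *)

(* The path from leaf i to leaf j crosses the edge of the dual tree attached to
   the arc e, whose end points are the triangles t1 and t2, turning as
   prescribed by turn1 at t1 and by turn2 at t2. *)
Definition passes (n : nat) (T : {set {set 'I_n}})
    (turn1 turn2 : {set 'I_(n.*2)} -> {set 'I_(n.*2)} -> {set 'I_(n.*2)} -> bool)
    (i j : 'I_n) (e : {set 'I_n}) : Prop :=
  exists2 s, dual_path (hat T) (leaf i) (leaf j) s &
    exists x t1 t2 y,
      [/\ infix [:: x; t1; t2; y] (leaf i :: s), t1 :&: t2 = old_arc e,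
          turn1 x t1 t2 & turn2 t1 t2 y].

Definition sigma (n : nat) (T : {set {set 'I_n}}) (i j : 'I_n) (e : {set 'I_n})
    : int :=
  if `[< passes T (@turns_left _) (@turns_right _) i j e >] then 1
  else if `[< passes T (@turns_right _) (@turns_left _) i j e >] then -1
  else 0.

(* A^(2n-3), with coordinates indexed by the 2n-3 arcs of T. *)
Notation arc_space A T := {ffun {e | e \in T} -> A^o}.

(* f_ab is arc_basis A T [set a; b]. *)
Definition arc_basis (A : nzRingType) (n : nat) (T : {set {set 'I_n}})
    (e : {set 'I_n}) : arc_space A T :=
  [ffun e' => (val e' == e)%:R].

Definition gvec (n : nat) (T : {set {set 'I_n}}) (i j : 'I_n)
    : arc_space int T :=
  \sum_(e in T) sigma T i j e *: arc_basis int T e.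

(** * Weights *)

Definition quadrilateral_weight_map (R : realType) (n : nat)
    (T : {set {set 'I_n}}) (wT : {linear arc_space R T -> R^o}) : Prop :=
  let f a b := arc_basis R T [set a; b]%SET in
  forall a b c d : 'I_n, cw4 a b c d ->
    [set a; b]%SET \in T -> [set b; c]%SET \in T -> [set c; d]%SET \in T ->
    [set a; d]%SET \in T -> [set a; c]%SET \in T ->
    wT (f a d + f b c) > wT (f a b + f c d).

(* The pairs i < j, which index the Plücker variables. *)
Definition pidx (n : nat) := {ij : 'I_n * 'I_n | (ij.1 < ij.2)%N}.

Definition weight_vector (R : realType) (n : nat) (T : {set {set 'I_n}})
    (wT : {linear arc_space R T -> R^o}) (ij : pidx n) : R :=
  wT [ffun e => (gvec T (val ij).1 (val ij).2 e)%:~R].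

(** * Ideals, as classical sets *)

Definition ideal_gen (P : comNzRingType) (G : set P) : set P :=
  [set f | exists2 s : seq (P * P),
     (forall u, u \in s -> G u.2) & f = \sum_(u <- s) u.1 * u.2]%classic.

Definition prime_ideal (P : comNzRingType) (J : set P) : Prop :=
  idealr_closed (mem J) /\ prime_idealr_closed (mem J).

Definition minimal_generating_set (P : comNzRingType) (J G : set P) : Prop :=
  ideal_gen G = J /\
  forall G' : set P, (G' `<=` G)%classic -> ideal_gen G' = J -> G' = G.

Definition is_binomial (K : nzRingType) (N : nat) (f : {mpoly K[N]}) : Prop :=
  size (msupp f) = 2%N.

(* An ideal generated by binomials (each with exactly two terms). *)
Definition binomial_ideal (K : comNzRingType) (N : nat) (J : set {mpoly K[N]})
    : Prop :=
  exists2 G : set {mpoly K[N]},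
    (forall g, G g -> is_binomial g) & ideal_gen G = J.

Definition toric_ideal (K : comNzRingType) (N : nat) (J : set {mpoly K[N]})
    : Prop :=
  binomial_ideal J /\ prime_ideal J.

(** * The Plücker ideal and initial ideals *)

Notation plucker_ring R n := {mpoly R[i][#|{: pidx n}|]}.

Definition pvar (R : realType) (n : nat) (ij : pidx n) : plucker_ring R n :=
  'X_(enum_rank ij).

(* p_ij for arbitrary i and j, with p_ji = - p_ij (and p_ii = 0). *)
Definition plucker_coord (R : realType) (n : nat) (i j : 'I_n)
    : plucker_ring R n :=
  if insub (i, j) is Some ij then pvar R ij
  else if insub (j, i) is Some ji then - pvar R ji else 0.

Definition plucker_rel (R : realType) (n : nat) (i j k l : 'I_n)
    : plucker_ring R n :=
  plucker_coord R i j * plucker_coord R k l -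
  plucker_coord R i k * plucker_coord R j l +
  plucker_coord R i l * plucker_coord R j k.

Definition plucker_ideal (R : realType) (n : nat) : set (plucker_ring R n) :=
  ideal_gen [set f | exists i j k l : 'I_n,
    cw4 i j k l /\ f = plucker_rel R i j k l]%classic.
Arguments plucker_ideal : clear implicits.

Definition mnm_weight (R : realType) (n : nat) (w : pidx n -> R)
    (m : 'X_{1..#|{: pidx n}|}) : R :=
  \sum_(x < #|{: pidx n}|) w (enum_val x) *+ m x.

Definition initial_form (R : realType) (n : nat) (w : pidx n -> R)
    (f : plucker_ring R n) : plucker_ring R n :=
  \sum_(m <- msupp f |
        all (fun m' => mnm_weight w m <= mnm_weight w m') (msupp f))
    f@_m *: 'X_[m].

Definition initial_ideal (R : realType) (n : nat) (w : pidx n -> R)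
    (I : set (plucker_ring R n)) : set (plucker_ring R n) :=
  ideal_gen (initial_form w @` I)%classic.

(* p_ik p_jl is plus or minus a single monomial, whose exponent this is. *)
Definition crossing_mnm (R : realType) (n : nat) (i j k l : 'I_n)
    : 'X_{1..#|{: pidx n}|} :=
  mlead (plucker_coord R i k * plucker_coord R j l).

(* Main.v *)
Require Import Defs.
From HB Require Import structures.
From mathcomp Require Import all_boot all_order all_algebra.
From mathcomp Require Import boolp classical_sets reals.
From mathcomp Require Import complex mpoly.
From mathcomp Require Import zify ring lra.

Set Implicit Arguments.
Unset Strict Implicit.
Unset Printing Implicit Defensive.

Import Order.TTheory GRing.Theory Num.Theory.
Local Open Scope ring_scope.

(** Number the leaves [i] of the dual tree by the vertices of the polygon.  The
    leaf [i] lies just before the vertex [i], so that the arc of the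
    triangulation from [a] to [b] separates the leaves [i] and [j] when exactly
    one of them lies in the cyclic interval from [a] (excluded) to [b].  Write
    [chi a b i j] for this crossing number.

    The path from leaf [i] to leaf [j] crosses the two sides of the
    quadrilateral around an arc in one of six ways, and inspection shows that
    twice its turning sign at the arc is an alternating sum of the crossing
    numbers of the four sides ([sigma_seg], [sigma_corner]).  Hence the weight
    of the variable with indices [i], [j] is a sum of crossing numbers with
    the arcs of the triangulation, plus terms attached to the leaves.
    Collecting terms triangle by triangle, the coefficient of an interior arc is
    the difference in the condition on quadrilateral weight maps, and is thus
    negative ([weight_tree]): the weight is minus a tree metric on the dual tree,
    up to leaf terms.

    Let [i < j < k < l].  Some arc of the triangulation separates [i], [j] from
    [k], [l], or [j], [k] from [i], [l], and two arcs of different kinds would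
    cross ([quartet_split]).  So the crossing monomial has the same weight and
    the same crossing numbers as exactly one of the two other monomials of the
    Plücker relation, and is lighter than the remaining one: the initial form of
    the relation is a binomial that contains the crossing monomial
    ([quartet_cases]).

    Let [K] be the ideal of these binomials.  Uncrossing pairs of arcs shows that
    every monomial is congruent modulo [K] to a non-crossing monomial with the
    same crossing numbers, and modulo the Plücker ideal to that monomial plus
    heavier non-crossing ones ([normal_form]).  Two facts on non-crossing
    monomials turn this into the theorem.  They are linearly independent modulo
    the Plücker ideal, since a generic matrix with two rows gives them distinct
    leading monomials ([noncross_independent]); comparing terms of least weight,
    initial forms of elements of the Plücker ideal lie in [K]
    ([initial_form_in]).  And a non-crossing monomial is determined by its
    crossing numbers with the arcs of a triangulation, because crossing numbers
    satisfy a tropical Ptolemy relation that computes them along flips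
    ([tropical_exchange], [chi_arcs_determine]); so [K] is the kernel of the
    monomial map given by the crossing numbers, and is prime
    ([crossing_map_ker]).

    Finally, by the same rigidity a binomial of [K] with a term that divides a
    crossing monomial is a multiple of the form of that quartet
    ([binomial_of_quartet]), which identifies all minimal generating sets of
    binomials. *)

(** * Cyclic order *)

(** The position of [x] when the polygon is read clockwise from [i].  Cyclic
    order is invariant under rotation, and reading from a well-chosen vertex
    turns a statement about cyclic order into one about inequalities. *)
Definition cwdist (m : nat) (i x : 'I_m) : nat :=
  if (i <= x)%N then (x - i)%N else (x + m - i)%N.

Definition cwn3 (a b c : nat) : bool :=
  [|| (a < b < c)%N, (b < c < a)%N | (c < a < b)%N].

Definition cwn4 (a b c d : nat) : bool := cwn3 a b c && cwn3 c d a.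

Lemma cwdistnn (m : nat) (i : 'I_m) : cwdist i i = 0%N.
Proof. by rewrite /cwdist leqnn subnn. Qed.

Lemma eq_cwdist (m : nat) (i a b : 'I_m) : (a == b) = (cwdist i a == cwdist i b).
Proof.
have := ltn_ord a; have := ltn_ord b; have := ltn_ord i.
rewrite /cwdist -val_eqE /=; case: (leqP i a); case: (leqP i b); lia.
Qed.

Lemma cw3_cwdist (m : nat) (i a b c : 'I_m) :
  cw3 a b c = cwn3 (cwdist i a) (cwdist i b) (cwdist i c).
Proof.
have := ltn_ord a; have := ltn_ord b; have := ltn_ord i; have := ltn_ord c.
rewrite /cwdist /cw3 /cwn3.
by case: (leqP i a); case: (leqP i b); case: (leqP i c); lia.
Qed.

Lemma cw4_cw3 (m : nat) (a b c d : 'I_m) : cw4 a b c d = cw3 a b c && cw3 c d a.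
Proof. by rewrite /cw4 /cw3; lia. Qed.

Lemma cw4_cwdist (m : nat) (i a b c d : 'I_m) :
  cw4 a b c d = cwn4 (cwdist i a) (cwdist i b) (cwdist i c) (cwdist i d).
Proof. by rewrite cw4_cw3 !(cw3_cwdist i). Qed.

Definition crosses (m : nat) (a c b d : 'I_m) : bool :=
  cw4 a b c d || cw4 a d c b.

Definition seg (m : nat) (a b v : 'I_m) : bool := (v == a) || cw3 a v b.

(* Read clockwise from the vertex [i] and decide by linear arithmetic. *)
Ltac cyc i :=
  rewrite ?/crosses ?/seg ?(cw4_cwdist i) ?(cw3_cwdist i) ?(eq_cwdist i) ?cwdistnn
    /cwn4 /cwn3 ?ltn0 ?andbF ?orbF /=;
  repeat match goal with
  | |- context [cwdist ?j ?x] => generalize (cwdist j x); intro end;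
  clear; lia.

(** * Triangulations as relations *)

Lemma set2_eq (T : finType) (a b c d : T) : [set a; b]%SET = [set c; d]%SET ->
  (a = c /\ b = d) \/ (a = d /\ b = c).
Proof.
move=> e; have := set21 a b; have := set22 a b.
have := set21 c d; have := set22 c d; rewrite -e {3 4}e !inE.
by do 4 (case/orP=> /eqP ?); subst; auto.
Qed.

(** The arcs of a triangulation as a relation between vertices.  Maximality is
    expressed arc by arc, which is how it is used, and which also suits
    triangulations given by a formula. *)
Definition tri_rel (m : nat) (E : rel 'I_m) : Prop :=
  [/\ forall a b, E a b -> a != b,
      forall a b, E a b = E b a,
      forall a b c d, E a c -> E b d -> ~~ crosses a c b d &
      forall a c, a != c ->
        (forall b d, E b d -> ~~ crosses a c b d) -> E a c].

Lemma crossing_set2 (m : nat) (a b c d : 'I_m) :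
  crossing [set a; c]%SET [set b; d]%SET = crosses a c b d.
Proof.
apply/idP/idP.
  case/existsP=> i /existsP[j /existsP[k /existsP[l /and3P[]]]].
  move=> h /eqP/set2_eq[] [? ?] /eqP/set2_eq[] [? ?]; subst;
    rewrite /crosses; move: h; rewrite /cw4; lia.
case/orP=> h; apply/existsP; exists a; apply/existsP.
  by exists b; apply/existsP; exists c; apply/existsP; exists d; rewrite h !eqxx.
exists d; apply/existsP; exists c; apply/existsP; exists b.
by rewrite h eqxx /= finset.setUC eqxx.
Qed.

Definition arc_rel (m : nat) (U : {set {set 'I_m}}) : rel 'I_m :=
  fun a b => [set a; b]%SET \in U.

Lemma arc_rel_tri (m : nat) (U : {set {set 'I_m}}) :
  triangulation U -> tri_rel (arc_rel U).
Proof.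
case/maxsetP=> /andP[/forall_inP U2 /forall_inP Unc] Umax; split.
- by move=> a b /U2; rewrite cards2; case: (a != b).
- by move=> a b; rewrite /arc_rel finset.setUC.
- move=> a b c d /Unc/forall_inP/[apply].
  by rewrite crossing_set2.
move=> a c nac hac; rewrite /arc_rel.
rewrite -(Umax ([set a; c]%SET |: U)%SET) ?setU11 ?finset.subsetUr //.
have cross2 (e e' : {set 'I_m}) : crossing e e' -> crossing e' e.
  case/existsP=> i /existsP[j /existsP[k /existsP[l /and3P[h /eqP-> /eqP->]]]].
  by move: h; rewrite crossing_set2 /crosses /cw4; lia.
have nca (e : {set 'I_m}) : e \in U -> ~~ crossing [set a; c]%SET e.
  move=> eU; have /cards2P[b [d [_ ee]]] := U2 _ eU.
  by subst e; rewrite crossing_set2; apply: hac.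
apply/andP; split; apply/forall_inP=> e; rewrite !inE => /predU1P[->|eU].
- by rewrite cards2 nac.
- exact: U2.
- apply/forall_inP=> e'; rewrite !inE => /predU1P[->|/nca //].
  by rewrite crossing_set2 /crosses /cw4; lia.
- apply/forall_inP=> e'; rewrite !inE => /predU1P[->|]; last by move/forall_inP: (Unc _ eU); apply.
  by apply/negP=> /cross2; apply/negP; apply: nca.
Qed.

Lemma tri_rel_triangulation (m : nat) (U : {set {set 'I_m}}) :
  (forall e, e \in U -> exists a b, e = [set a; b]%SET) ->
  tri_rel (arc_rel U) -> triangulation U.
Proof.
move=> U2 [Eirr Esym Enc Emax]; apply/maxsetP; split.
  apply/andP; split; apply/forall_inP=> e eU.
    by have [a [b ee]] := U2 _ eU; subst e; rewrite cards2 Eirr.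
  apply/forall_inP=> e' e'U.
  have [a [b ee]] := U2 _ eU; have [a' [b' ee']] := U2 _ e'U; subst e e'.
  by rewrite crossing_set2 Enc.
move=> B /andP[/forall_inP B2 /forall_inP Bnc] UB.
apply/eqP; rewrite finset.eqEsubset UB andbT; apply/fintype.subsetP=> e eB.
have /cards2P[a [c [nac ee]]] := B2 _ eB; subst e.
apply: Emax => // b d /(fintype.subsetP UB) bd.
by move/forall_inP: (Bnc _ eB) => /(_ _ bd); rewrite crossing_set2.
Qed.

Section TriRelProjections.
Variables (m : nat) (E : rel 'I_m).
Hypothesis triE : tri_rel E.

Lemma tri_irr a b : E a b -> a != b.
Proof. by case: triE => + _ _ _; apply. Qed.

Lemma tri_sym a b : E a b = E b a.
Proof. by case: triE. Qed.

Lemma tri_nc a b c d : E a c -> E b d -> ~~ crosses a c b d.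
Proof. by case: triE => _ _ + _; apply. Qed.

Lemma tri_max a c :
  a != c -> (forall b d, E b d -> ~~ crosses a c b d) -> E a c.
Proof. by case: triE => _ _ _; apply. Qed.

End TriRelProjections.

Section TriRel.
Variables (m : nat) (E : rel 'I_m).
Hypothesis triE : tri_rel E.

Let Esym := tri_sym triE.
Let Enc := tri_nc triE.
Let Emax := tri_max triE.

Definition ncross (a c : 'I_m) : nat :=
  #|[set bd : 'I_m * 'I_m | E bd.1 bd.2 && crosses a c bd.1 bd.2]|.

Lemma ncrossC a c : ncross a c = ncross c a.
Proof.
apply: eq_card => -[b d]; rewrite !inE /=; congr andb.
by rewrite /crosses /cw4; lia.
Qed.

Lemma crossing_arc a c : a != c -> ~~ E a c ->
  exists b d, E b d /\ cw4 a b c d.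
Proof.
move=> nac nE; apply: contrapT => H; move/negP: nE; apply; apply: Emax => // b d bd.
apply/negP=> /orP[] h; apply: H; first by exists b, d.
by exists d, b; rewrite Esym.
Qed.

(** An arc of [E] that crosses a side of the quadrilateral cannot cross the
    diagonal [ik] of [E], so it leaves through [jl]; and [ik] itself crosses
    [jl] but no side.  This drives all inductions on crossing numbers. *)
Lemma ncross_quad i j k l : cw4 i j k l -> E i k ->
  [/\ (ncross i j < ncross j l)%N, (ncross j k < ncross j l)%N,
      (ncross k l < ncross j l)%N & (ncross i l < ncross j l)%N].
Proof.
move=> q ik.
suff H (x y : 'I_m) : ~~ crosses x y i k ->
   (forall b d, ~~ crosses i k b d -> crosses x y b d -> crosses j l b d) ->
   (ncross x y < ncross j l)%N.
  split; apply: H; try (move=> b d); move: q.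
  - cyc i.
  - cyc i.
  - cyc k.
  - cyc k.
  - cyc k.
  - cyc k.
  - cyc i.
  - cyc i.
move=> nik sub; apply: proper_card; apply/properP; split.
  apply/fintype.subsetP=> -[b d]; rewrite !inE /= => /andP[bd /sub-> //].
    by rewrite bd.
  exact: Enc.
exists (i, k); rewrite !inE /= ik //=.
by move: q; cyc i.
Qed.

(* Read clockwise from [i], whether [a] and [c] lie in opposite parts among
   the four intervals that start at [i], [j], [k] and [l]. *)
Let opp4 (j k l a c : nat) : bool :=
  (a < j)%N && (k <= c < l)%N || (j <= a < k)%N && (l <= c)%N.

Let opp4_step j k l a c x y : (j < k)%N -> (k < l)%N -> opp4 j k l a c ->
  (a < x < c)%N -> (c < y)%N || (y < a)%N ->
  ~~ opp4 j k l x y -> ~~ opp4 j k l y x ->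
  [|| opp4 j k l x c, opp4 j k l y c, opp4 j k l a x | opp4 j k l a y].
Proof. rewrite /opp4; lia. Qed.

(** Among the segments that join opposite parts take one that crosses the
    fewest arcs of [E].  If it is crossed by an arc [xy] of [E], one of the four
    sides of the resulting quadrilateral still joins opposite parts, and
    crosses fewer arcs. *)
Lemma opposite_arc i j k l : cw4 i j k l ->
  exists a c, E a c /\
    ((seg i j a /\ seg k l c) \/ (seg j k a /\ seg l i c)).
Proof.
move=> q.
have [J0 JK KL] : [/\ (0 < cwdist i j)%N, (cwdist i j < cwdist i k)%N &
                      (cwdist i k < cwdist i l)%N].
  by split; move: q; cyc i.
pose opp a c := opp4 (cwdist i j) (cwdist i k) (cwdist i l) (cwdist i a) (cwdist i c).
have oppP a c : opp a c ->
    (seg i j a /\ seg k l c) \/ (seg j k a /\ seg l i c).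
  rewrite /opp /opp4 => /orP[] /andP[ha hc]; [left|right]; split;
    by move: J0 JK KL ha hc; cyc i.
suff H N a c : (ncross a c < N)%N -> opp a c -> exists a c, E a c /\ opp a c.
  have [||a [c [ac /oppP]]] := H (ncross i k).+1 i k => //; last by exists a, c.
  by rewrite /opp /opp4 cwdistnn J0 leqnn KL.
elim: N a c => // N IH a c; rewrite ltnS => hN hac.
have [ac|nE] := boolP (E a c); first by exists a, c.
have lt_ac : (cwdist i a < cwdist i c)%N by move: hac; rewrite /opp /opp4; lia.
have nac : a != c by rewrite (eq_cwdist i) neq_ltn lt_ac.
have [x [y [xy q']]] := crossing_arc nac nE.
have [|h1 h2 h3 h4] := @ncross_quad x c y a _ xy; first by move: q'; cyc a.
have [t|nt] := boolP (opp x y); first by exists x, y.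
have [t|nt'] := boolP (opp y x); first by exists y, x; rewrite Esym.
have hx : (cwdist i a < cwdist i x < cwdist i c)%N by move: q' lt_ac; cyc i.
have hy : (cwdist i c < cwdist i y)%N || (cwdist i y < cwdist i a)%N.
  by move: q' lt_ac; cyc i.
have {}hN : (ncross c a <= N)%N by rewrite ncrossC.
case/or4P: (opp4_step JK KL hac hx hy nt nt') => h.
- by apply: (IH x c) => //; apply: leq_trans h1 hN.
- by apply: (IH y c) => //; rewrite ncrossC; apply: leq_trans h2 hN.
- by apply: (IH a x) => //; rewrite ncrossC; apply: leq_trans h4 hN.
- by apply: (IH a y) => //; rewrite ncrossC; apply: leq_trans h3 hN.
Qed.
End TriRel.

(** * Boundary edges and triangles *)

Lemma ltn_cwdist (m : nat) (a b : 'I_m) : (cwdist a b < m)%N.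
Proof.
have := ltn_ord a; have := ltn_ord b; rewrite /cwdist; case: (leqP a b); lia.
Qed.

Lemma cwdist_ordS (m : nat) (a b : 'I_m) :
  cwdist a (ordS b) = if ((cwdist a b).+1 == m)%N then 0%N else (cwdist a b).+1.
Proof.
have hb := ltn_ord b; have ha := ltn_ord a.
have e : val (ordS b) = if (b.+1 == m)%N then 0%N else b.+1.
  rewrite /=; case: eqP => [->|ne]; first by rewrite modnn.
  by rewrite modn_small //; lia.
rewrite /cwdist [nat_of_ord (ordS b)]e.
by case: (b.+1 =P m) => ?; case: (leqP a b) => ?; case: leqP => ?; case: eqP; lia.
Qed.

Lemma cwdist_inj (m : nat) (i : 'I_m) : injective (cwdist i).
Proof. by move=> a b /eqP; rewrite -eq_cwdist => /eqP. Qed.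

Section Triangles.
Variables (m : nat) (E : rel 'I_m).
Hypothesis triE : tri_rel E.

Let Eirr := tri_irr triE.
Let Esym := tri_sym triE.
Let Enc := tri_nc triE.
Let Emax := tri_max triE.

Lemma boundary_arc v : (1 < m)%N -> E v (ordS v).
Proof.
move=> m1; have e : cwdist v (ordS v) = 1%N.
  by rewrite cwdist_ordS cwdistnn; case: eqP => //; lia.
apply: Emax; first by rewrite (eq_cwdist v) cwdistnn e.
move=> b d bd; move: e; cyc v.
Qed.

(** Take the arc [ab] of [E] with [b] between [a] and [c] and closest to [c].
    If [b] and [c] are not adjacent, an arc joining opposite parts for the
    quadruple [a], [a + 1], [b + 1], [c] exists; by the choice of [b], and
    because it crosses neither [ab] nor [ac], it is [bc]. *)
Lemma third_vertex a c v : E a c -> cw3 a v c ->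
  exists b, [/\ cw3 a b c, E a b & E b c].
Proof.
move=> ac avc.
have m1 : (1 < m)%N.
  by have := Eirr ac; rewrite -val_eqE /=; have := ltn_ord a; have := ltn_ord c; lia.
have hc := ltn_cwdist a c.
have [hv0 hvc] : (0 < cwdist a v)%N /\ (cwdist a v < cwdist a c)%N.
  by split; move: avc; cyc a.
have ha' : cwdist a (ordS a) = 1%N.
  by rewrite cwdist_ordS cwdistnn; case: eqP => //; lia.
have P0 : cw3 a (ordS a) c && E a (ordS a).
  rewrite boundary_arc // andbT; move: hv0 hvc ha'; cyc a.
case: (@arg_maxnP _ (ordS a) (fun b => cw3 a b c && E a b) (cwdist a) P0) => b.
move=> /andP[abc ab] bmax.
have [hb0 hbc] : (0 < cwdist a b)%N /\ (cwdist a b < cwdist a c)%N.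
  by split; move: abc; cyc a.
exists b; split=> //.
have hb' : cwdist a (ordS b) = (cwdist a b).+1.
  by rewrite cwdist_ordS; case: eqP => //; lia.
have [e|ne] := eqVneq c (ordS b); first by rewrite e boundary_arc.
have lt_b'c : (cwdist a (ordS b) < cwdist a c)%N.
  by move: ne; rewrite (eq_cwdist a) hb'; lia.
have [|x [y [xy [[h1 h2]|[h1 h2]]]]] :=
    @opposite_arc m E triE a (ordS a) (ordS b) c.
- by move: ha' hb' lt_b'c hb0; cyc a.
- have ex : x = a by apply: (@cwdist_inj _ a); move: h1 ha'; cyc a.
  subst x; have : (cwdist a (ordS b) <= cwdist a y < cwdist a c)%N.
    by move: h2 lt_b'c hb'; cyc a.
  move=> hy; have /bmax : cw3 a y c && E a y.
    by rewrite xy andbT; move: hy hb'; cyc a.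
  by move=> h; exfalso; move: h hy hb' => /=; clear; lia.
have hx : (0 < cwdist a x <= cwdist a b)%N.
  by move: h1 ha' hb' hb0; cyc a.
have hy : (cwdist a c <= cwdist a y)%N by move: h2 hb0 hbc; cyc a.
have ey : y = c.
  apply: (@cwdist_inj _ a); move: (Enc ac xy) hx hy hbc; cyc a.
have ex : x = b.
  by subst y; apply: (@cwdist_inj _ a); move: (Enc ab xy) hx hbc; cyc a.
by subst.
Qed.

Lemma third_vertex_uniq a b b' c : cw3 a b c -> cw3 a b' c ->
  E a b -> E b c -> E a b' -> E b' c -> b = b'.
Proof.
move=> h h' ab bc ab' b'c; apply: (@cwdist_inj _ a).
move: (Enc ab' bc) (Enc ab b'c) h h'; cyc a.
Qed.

End Triangles.

(** * The planar dual tree *)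

Lemma ordS_neq (m : nat) (a : 'I_m) : (1 < m)%N -> ordS a != a.
Proof.
move=> m1; rewrite (eq_cwdist a) cwdistnn cwdist_ordS cwdistnn.
by have -> : (1 == m)%N = false by lia.
Qed.

Lemma ordS_asym (m : nat) (a b : 'I_m) : (2 < m)%N -> b = ordS a -> a != ordS b.
Proof.
move=> m2 ->; rewrite (eq_cwdist a) cwdistnn !cwdist_ordS cwdistnn.
have -> : (1 == m)%N = false by lia.
by have -> : (2 == m)%N = false by lia.
Qed.

Section PathCrossing.
Variables (T : eqType) (e : rel T).

Lemma path_switch (P : pred T) x s : path e x s -> P x -> ~~ P (last x s) ->
  exists y z, [/\ P y, ~~ P z, e y z & infix [:: y; z] (x :: s)].
Proof.
elim: s x => [|y s IH] x /=; first by move=> _ ->.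
move=> /andP[exy ps] Px Pl.
have [Py|Py] := boolP (P y); last first.
  by exists x, y; split=> //; rewrite !eqxx prefix0s.
have [z [t [? ? ? inf]]] := IH _ ps Py Pl.
by exists z, t; split=> //; apply/orP; right.
Qed.

Lemma infix_path x s y z : path e x s -> infix [:: y; z] (x :: s) -> e y z.
Proof.
move=> + /infixP[s1 [s2 es]]; case: s1 es => [|x' s1] [-> ->] /=.
  by case/andP.
by rewrite cat_path /= => /and3P[_ _ /andP[]].
Qed.

(** The common entry [y] has a single position in [s], which aligns the two
    factors. *)
Lemma infix_glue (u v s : seq T) y : uniq s ->
  infix (rcons u y) s -> infix (y :: v) s -> infix (rcons u y ++ v) s.
Proof.
move=> us /infixP[s1 [s2 es]] /infixP[s3 [s4 es']].
have e1 : s = (s1 ++ u) ++ y :: s2 by rewrite es cat_rcons catA.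
have i1 : index y s = size (s1 ++ u).
  have : y \notin s1 ++ u.
    by move: us; rewrite e1 cat_uniq /= negb_or => /and3P[_ /andP[]].
  by rewrite e1 index_cat => /negPf->; rewrite /= eqxx addn0.
have i2 : index y s = size s3.
  have : y \notin s3.
    by move: us; rewrite es' cat_uniq /= negb_or => /and3P[_ /andP[]].
  by rewrite es' index_cat => /negPf->; rewrite /= eqxx addn0.
have d1 : drop (index y s).+1 s = s2.
  by rewrite i1 {1}e1 -cat_rcons drop_size_cat // size_rcons.
have d2 : drop (index y s).+1 s = v ++ s4.
  by rewrite i2 {1}es' cat_cons -cat_rcons drop_size_cat // size_rcons.
by apply/infixP; exists s1, s4; rewrite es -d1 d2 -!catA.
Qed.

End PathCrossing.

Section DualTree.
Variables (m : nat) (U : {set {set 'I_m}}).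
Hypotheses (m2 : (2 < m)%N) (triU : triangulation U).

Let E := arc_rel U.
Let triE : tri_rel E := arc_rel_tri triU.
Let m1 : (1 < m)%N := ltnW m2.
Let Eirr := tri_irr triE.
Let Esym := tri_sym triE.
Let Enc := tri_nc triE.

Definition node (x : {set 'I_m}) : bool := x \in (triangles U :|: boundary m)%SET.
Definition bedge (v : 'I_m) : {set 'I_m} := [set v; ordS v]%SET.

Lemma node_bedge v : node (bedge v).
Proof. by rewrite /node inE; apply/orP; right; apply/imsetP; exists v. Qed.

Lemma cw3_uniq (a b c : 'I_m) : cw3 a b c -> [/\ a != b, b != c & a != c].
Proof. by split; rewrite -val_eqE /=; move: H; rewrite /cw3; lia. Qed.

Lemma node_triangle a b c : cw3 a b c -> E a b -> E b c -> E a c ->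
  node [set a; b; c]%SET.
Proof.
move=> h ab bc ac; rewrite /node inE; apply/orP; left; rewrite inE.
have [nab nbc nac] := cw3_uniq h.
apply/andP; split.
  by rewrite finset.setUC cardsU1 cards2 !inE ![c == _]eq_sym (negPf nac) (negPf nbc) nab.
apply/forallP=> e; apply/implyP=> /andP[sub /cards2P[x [y [nxy ee]]]]; subst e.
have := fintype.subsetP sub x; have := fintype.subsetP sub y.
rewrite !inE !eqxx orbT /= => /(_ isT) hy /(_ isT) hx.
move: nxy; case/orP: hx => [/orP[]|] /eqP->; case/orP: hy => [/orP[]|] /eqP->;
  by rewrite ?eqxx // => _; rewrite -/(arc_rel U _ _) -/E // Esym.
Qed.

Lemma node_arc x u v : node x -> u \in x -> v \in x -> u != v -> E u v.
Proof.
rewrite /node inE => /orP[|/imsetP[w _ ->]].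
  rewrite inE => /andP[_ /forallP/(_ [set u; v]%SET)/implyP h] ux vx nuv.
  apply: h; rewrite cards2 nuv andbT; apply/fintype.subsetP=> z.
  by rewrite !inE => /orP[] /eqP->.
rewrite !inE => /orP[] /eqP-> /orP[] /eqP->; rewrite ?eqxx // => _.
  exact: boundary_arc.
by rewrite Esym; apply: boundary_arc.
Qed.

Lemma node_card x : node x -> (1 < #|x|)%N.
Proof.
rewrite /node inE => /orP[|/imsetP[w _ ->]]; first by rewrite inE => /andP[/eqP->].
by rewrite cards2 eq_sym ordS_neq.
Qed.

Lemma node2 a b : node [set a; b]%SET -> a != b -> b = ordS a \/ a = ordS b.
Proof.
move=> + nab; rewrite /node inE => /orP[|/imsetP[w _ e]].
  by rewrite inE cards2 nab.
have := set21 a b; have := set22 a b; rewrite e !inE.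
move=> /orP[] /eqP eb /orP[] /eqP ea; move: nab; rewrite ?ea ?eb ?eqxx //; auto.
Qed.

Definition cseg (a b v : 'I_m) : bool := [|| v == a, v == b | cw3 a v b].

(** The part of the dual tree on the clockwise side from [a] to [b] of the arc
    [ab].  When [ab] is a boundary edge, its leaf has both ends on either
    side, and is put on the side that has no other node. *)
Definition side (a b : 'I_m) (x : {set 'I_m}) : bool :=
  if x == [set a; b]%SET then b == ordS a else [forall v in x, cseg a b v].

Lemma side_cseg a b x v : side a b x -> v \in x -> cseg a b v.
Proof.
rewrite /side; case: eqP => [-> _|_ /forall_inP]; last exact.
by rewrite !inE /cseg => /orP[] ->; rewrite ?orbT.
Qed.

Lemma sideC a b x : E a b -> node x -> side b a x = ~~ side a b x.
Proof.
move=> ab nx; have nab := Eirr ab.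
rewrite /side (finset.setUC [set b]%SET).
case: eqP => [ex|nex].
  have := nx; rewrite ex => /node2/(_ nab)[] e.
    by rewrite -e eqxx; apply/negbTE; apply: ordS_asym.
  by rewrite -e eqxx; apply/esym; apply: ordS_asym.
have [z zx zab] : exists2 z, z \in x & z \notin [set a; b]%SET.
  apply/exists_inP; rewrite -negb_forall_in; apply/negP=> /forall_inP h.
  apply: nex; apply/eqP; rewrite eqEcard cards2 nab node_card // andbT.
  exact/fintype.subsetP.
have H v : v \in x -> v != z -> E z v
  by move=> vx nvz; apply: (node_arc nx) => //; rewrite eq_sym.
move: zab; rewrite !inE negb_or => /andP[za zb].
have [hz|hz] := boolP (cw3 a z b).
  have -> : [forall v in x, cseg a b v].
    apply/forall_inP=> v vx; have [->|vz] := eqVneq v z.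
      by rewrite /cseg hz !orbT.
    by move: (Enc ab (H _ vx vz)) hz nab; rewrite /cseg; cyc a.
  apply/negbTE/negP=> /forall_inP/(_ _ zx).
  by move: hz za zb; rewrite /cseg; cyc a.
have {}hz : cw3 b z a by move: hz za zb nab; cyc a.
have -> : [forall v in x, cseg b a v].
  apply/forall_inP=> v vx; have [->|vz] := eqVneq v z.
    by rewrite /cseg hz !orbT.
  by move: (Enc ab (H _ vx vz)) hz nab; rewrite /cseg; cyc b.
apply/esym/negP=> /forall_inP/(_ _ zx).
by move: hz za zb; rewrite /cseg; cyc a.
Qed.

Lemma side_sep a b x y : E a b -> node x -> node y ->
  side a b x -> ~~ side a b y -> x :&: y \subset [set a; b]%SET.
Proof.
move=> ab nx ny sx; rewrite -sideC // => sy.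
apply/fintype.subsetP=> v; rewrite inE => /andP[/(side_cseg sx) + /(side_cseg sy)].
by move: (Eirr ab); rewrite !inE /cseg; cyc a.
Qed.

Lemma adj_nodes x y : dual_adj U x y -> [/\ node x, node y, x != y & #|x :&: y| = 2%N].
Proof. by case/and4P=> ? ? ? /eqP. Qed.

Lemma side_step a b x y : E a b -> dual_adj U x y ->
  side a b x -> ~~ side a b y -> x :&: y = [set a; b]%SET.
Proof.
move=> ab /adj_nodes[nx ny _ c2] sx sy.
by apply/eqP; rewrite eqEcard (side_sep ab) // cards2 c2; case: (a != b).
Qed.

(** An arc has one node on either side: a leaf on an outer side of a boundary
    edge, a triangle otherwise. *)
Lemma node_side a b x : E a b -> node x -> a \in x -> b \in x -> side a b x ->
  (x = [set a; b]%SET /\ b = ordS a) \/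
  exists c, [/\ cw3 a c b, E a c, E c b & x = [set a; c; b]%SET].
Proof.
move=> ab nx ax bx sx; have nab := Eirr ab.
have := sx; rewrite /side; case: eqP => [-> /eqP|nex _]; first by left.
right; have [z zx zab] : exists2 z, z \in x & z \notin [set a; b]%SET.
  apply/exists_inP; rewrite -negb_forall_in; apply/negP=> /forall_inP h.
  apply: nex; apply/eqP; rewrite eqEcard cards2 nab node_card // andbT.
  exact/fintype.subsetP.
move: zab; rewrite !inE negb_or => /andP[za zb].
exists z; split.
- by move: (side_cseg sx zx) za zb; rewrite /cseg; cyc a.
- by apply: node_arc nx _ _ _ => //; rewrite eq_sym.
- exact: node_arc nx _ _ _.
apply/esym/eqP; rewrite eqEcard; apply/andP; split.
  by apply/fintype.subsetP=> v; rewrite !inE => /orP[/orP[]|] /eqP->.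
rewrite (finset.setUC [set a]%SET) -finset.setUA cardsU1 cards2 !inE negb_or za zb nab.
move: nx; rewrite /node inE => /orP[|/imsetP[w _ e]].
  by rewrite inE => /andP[/eqP->].
by rewrite e cards2; case: eqP.
Qed.

Lemma side_uniq a b x y : E a b -> node x -> node y ->
  [set a; b]%SET \subset x -> [set a; b]%SET \subset y ->
  side a b x -> side a b y -> x = y.
Proof.
move=> ab nx ny /fintype.subsetP sx /fintype.subsetP sy ax ay.
have [||[ex bS]|[c [acb ac cb ex]]] := node_side ab nx _ _ ax;
  rewrite ?sx ?set21 ?set22 //;
  have [||[ey bS']|[c' [acb' ac' cb' ey]]] := node_side ab ny _ _ ay;
  rewrite ?sy ?set21 ?set22 // ex ey //.
- have : cwdist a b = 1%N.
    by rewrite bS cwdist_ordS cwdistnn; case: eqP => //; lia.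
  by move: acb'; cyc a.
- have : cwdist a b = 1%N.
    by rewrite bS' cwdist_ordS cwdistnn; case: eqP => //; lia.
  by move: acb; cyc a.
by rewrite (third_vertex_uniq triE acb acb').
Qed.

Lemma adj_side a b x y : E a b -> dual_adj U x y -> x :&: y = [set a; b]%SET ->
  side a b y = ~~ side a b x.
Proof.
move=> ab /adj_nodes[nx ny nxy _] exy.
have sx : [set a; b]%SET \subset x by rewrite -exy finset.subsetIl.
have sy : [set a; b]%SET \subset y by rewrite -exy finset.subsetIr.
have [hx|hx] := boolP (side a b x).
  apply/negP=> hy; move/eqP: nxy; apply; exact: side_uniq hx hy.
rewrite -sideC // in hx; apply: contraTT isT => hy; rewrite -sideC // in hy.
have ba : E b a by rewrite Esym.
exfalso; move/eqP: nxy; apply; rewrite finset.setUC in sx sy; exact: side_uniq hx hy.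
Qed.

(** There is only one node on either side of an arc to cross it from and to, so
    a path that crossed the arc twice would visit a node twice. *)
Lemma cross_once a b x0 x1 s y z : E a b -> dual_path U x0 x1 s ->
  infix [:: y; z] (x0 :: s) -> y :&: z = [set a; b]%SET -> side a b y ->
  side a b x0 /\ side b a x1.
Proof.
move=> ab /and3P[ps /eqP<- us] inf eyz sy.
have ayz := infix_path ps inf.
have sz : ~~ side a b z by rewrite (adj_side ab ayz eyz) sy.
have [ny nz nyz _] := adj_nodes ayz.
have suby : [set a; b]%SET \subset y by rewrite -eyz finset.subsetIl.
have subz : [set a; b]%SET \subset z by rewrite -eyz finset.subsetIr.
have ba : E b a by rewrite Esym.
have switch y' z' : dual_adj U y' z' -> ~~ side a b y' -> side a b z' ->
    y' = z /\ z' = y.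
  move=> a' sy' sz'; have [ny' nz' _ _] := adj_nodes a'.
  have e' : y' :&: z' = [set b; a]%SET.
    by apply: side_step; rewrite 1?sideC // sz'.
  split; last first.
    apply: (side_uniq ab) => //; by rewrite finset.setUC -e' finset.subsetIr.
  apply: (side_uniq ba) => //; rewrite 1?sideC // -?e' ?finset.subsetIl //.
  by rewrite e' finset.setUC.
case/infixP: inf => s1 [s2 es].
have dis u : u \in rcons s1 y -> u \in z :: s2 -> false.
  move: us; rewrite es -cat_rcons cat_uniq => /and3P[_ /hasPn h _] u1 /h.
  by rewrite u1.
have [p1 p2] : path (dual_adj U) z s2 /\
   (s1 = [::] /\ x0 = y \/
    exists s1', s1 = x0 :: s1' /\ path (dual_adj U) x0 (rcons s1' y)).
  case: s1 es {dis} => [|x' s1] [ex es]; subst.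
    by move: ps => /= /andP[_ ->]; split=> //; left.
  move: ps; rewrite cat_path /= => /and3P[h1 h2 /andP[_ h3]]; split => //.
  by right; exists s1; split=> //; rewrite rcons_path h1.
have el : last x0 s = last z s2.
  by rewrite -[last x0 s]/(last x0 (x0 :: s)) es last_cat.
split.
  case: p2 => [[_ ->] //|[s1' [e1 p2]]].
  apply: contraT => nx0.
  have [||y' [z' [sy' sz' a' inf']]] := path_switch (P := predC (side a b)) p2.
  - exact: nx0.
  - by rewrite /= negbK last_rcons.
  have [ey _] := switch _ _ a' sy' (negbNE sz').
  have /dis : z \in rcons s1 y.
    rewrite e1 rcons_cons -ey; move/infixP: inf' => [u1 [u2 ->]].
    by rewrite mem_cat !inE eqxx orbT.
  by rewrite !inE eqxx => /(_ isT).
have nl : node (last z s2).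
  move: p1; case/lastP: s2 {es dis el} => // s2 t.
  rewrite rcons_path last_rcons => /andP[_ /adj_nodes[]] //.
rewrite sideC ?el //; apply/negP=> sl.
have [||y' [z' [sy' sz' a' inf']]] := path_switch (P := predC (side a b)) p1.
- exact: sz.
- by rewrite /= negbK.
have [_ ez] := switch _ _ a' sy' (negbNE sz').
have := dis y; rewrite mem_rcons mem_head => /(_ isT).
rewrite -ez; move/infixP: inf' => [u1 [u2 ->]].
by rewrite mem_cat !inE eqxx !orbT => /(_ isT).
Qed.

Lemma cross_infix a b x0 x1 s : E a b -> dual_path U x0 x1 s ->
  node x1 -> side a b x0 -> side b a x1 ->
  exists y z, [/\ infix [:: y; z] (x0 :: s), y :&: z = [set a; b]%SET,
                  side a b y & side b a z].
Proof.
move=> ab /and3P[ps /eqP<- us] n1 s0; rewrite sideC // => s1.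
have [y [z [sy sz ayz inf]]] := path_switch ps s0 s1.
have [ny nz _ _] := adj_nodes ayz.
by exists y, z; split=> //; rewrite 1?sideC //; apply: side_step.
Qed.

Lemma side_bedge a b v : E a b -> side a b (bedge v) = seg a b v.
Proof.
move=> ab; have nab := Eirr ab.
have hb : (0 < cwdist a b)%N.
  by move: nab; rewrite (eq_cwdist a) cwdistnn; lia.
have tS : cwdist a (ordS v) = if ((cwdist a v).+1 == m)%N then 0%N else (cwdist a v).+1.
  exact: cwdist_ordS.
have lv := ltn_cwdist a v; have lb := ltn_cwdist a b.
rewrite /side; case: eqP => [e|ne].
  have [||e'|e'] := @node2 a b => //; first by rewrite -e node_bedge.
    have -> : v = a.
      have := set21 v (ordS v); rewrite -/(bedge v) e !inE => /orP[/eqP //|/eqP ev].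
      have := set22 v (ordS v); rewrite -/(bedge v) e !inE ev => /orP[] /eqP.
        by move/esym/eqP; rewrite (negPf (ordS_asym m2 e')).
      by move/eqP; rewrite (negPf (ordS_neq _ m1)).
    by rewrite -e' eqxx /seg eqxx.
  have -> : v = b.
    have := set21 v (ordS v); rewrite -/(bedge v) e !inE => /orP[/eqP ev|/eqP //].
    have := set22 v (ordS v); rewrite -/(bedge v) e !inE ev => /orP[] /eqP.
      by move/eqP; rewrite (negPf (ordS_neq _ m1)).
    by move/esym/eqP; rewrite (negPf (ordS_asym m2 e')).
  by rewrite (negPf (ordS_asym m2 e')); apply/esym; move: nab; cyc a.
have -> : [forall v0 in bedge v, cseg a b v0] = cseg a b v && cseg a b (ordS v).
  apply/forall_inP/andP=> [h|[h1 h2] w].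
    by split; apply: h; rewrite !inE eqxx ?orbT.
  by rewrite !inE => /orP[] /eqP->.
have neq : ~~ ((cwdist a v == cwdist a b) && (cwdist a (ordS v) == 0%N)).
  apply/negP=> /andP[/eqP/(@cwdist_inj _ a) ev /eqP h]; apply: ne.
  have -> : a = ordS v by apply: (@cwdist_inj _ a); rewrite cwdistnn h.
  by rewrite ev finset.setUC.
move: tS neq lv lb hb; case: eqP; rewrite /cseg; cyc a.
Qed.

Lemma cwdist_lt (a b c : 'I_m) : cw3 a c b ->
  (cwdist a c < cwdist a b)%N /\ (cwdist c b < cwdist a b)%N.
Proof.
have := ltn_ord a; have := ltn_ord b; have := ltn_ord c.
rewrite /cw3 /cwdist; case: (leqP a c); case: (leqP a b); case: (leqP c b); lia.
Qed.

(** Walk towards the leaf [v]: the node [x] sees it through its side [ab]; the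
    triangle behind [ab] sees it through a side that cuts off fewer
    vertices. *)
Lemma connect_bedge N a b x v : (cwdist a b < N)%N -> E a b -> node x ->
  a \in x -> b \in x -> side b a x -> seg a b v ->
  connect (dual_adj U) x (bedge v).
Proof.
elim: N a b x => // N IH a b x; rewrite ltnS => hN ab nx ax bx sx hv.
have nab := Eirr ab; have ba : E b a by rewrite Esym.
have adj y : node y -> a \in y -> b \in y -> side a b y -> dual_adj U x y.
  move=> ny ay b_y sy; apply/and4P; split => //.
    by apply: contraTneq sx => ->; rewrite sideC // sy.
  have -> : x :&: y = [set a; b]%SET; last by rewrite cards2 nab.
  apply/eqP; rewrite finset.eqEsubset; apply/andP; split.
    by rewrite (finset.setUC [set a]%SET); by apply: (side_sep ba) => //; rewrite sideC ?sy.
  by apply/fintype.subsetP=> z; rewrite !inE => /orP[] /eqP->; apply/andP.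
have hb : (0 < cwdist a b)%N.
  by move: nab; rewrite (eq_cwdist a) cwdistnn; lia.
have lb := ltn_cwdist a b.
have ha' : cwdist a (ordS a) = 1%N.
  by rewrite cwdist_ordS cwdistnn; case: eqP => //; lia.
have [ebS|nbS] := eqVneq b (ordS a).
  have ev : v = a.
    by apply: (@cwdist_inj _ a); move: hv ha'; rewrite -ebS; cyc a.
  apply: connect1; rewrite ev; apply: adj; rewrite ?node_bedge // ?inE ?eqxx //.
    by rewrite -ebS eqxx orbT.
  by rewrite side_bedge // /seg eqxx.
have bet : cw3 a (ordS a) b by move: nbS ha' hb; cyc a.
have [c [acb ac cb]] := third_vertex triE ab bet.
have ny : node [set a; c; b]%SET by apply: node_triangle.
have side_y (g h w : 'I_m) : E g h -> w \in [set a; c; b]%SET ->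
    cw3 g w h -> side g h [set a; c; b]%SET.
  move=> gh wy gwh; apply: contraT; rewrite -sideC // => /side_cseg/(_ wy).
  by move: gwh; rewrite /cseg; cyc g.
have [t1 t2] := cwdist_lt acb.
apply: (connect_trans (connect1 (adj _ ny _ _ _))); rewrite ?inE ?eqxx ?orbT //.
  by apply: (side_y _ _ c); rewrite ?inE ?eqxx ?orbT.
have [hva|hva] := boolP (seg a c v).
  apply: (IH a c); rewrite ?inE ?eqxx ?orbT //; first exact: leq_trans t1 hN.
  apply: (side_y _ _ b); rewrite ?inE ?eqxx ?orbT //; first by rewrite Esym.
  by move: acb; cyc a.
apply: (IH c b); rewrite ?inE ?eqxx ?orbT //; first exact: leq_trans t2 hN.
  apply: (side_y _ _ a); rewrite ?inE ?eqxx ?orbT //; first by rewrite Esym.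
  by move: acb; cyc a.
by move: hva hv acb; cyc a.
Qed.

Lemma dual_path_exists u v : u != v -> exists s, dual_path U (bedge u) (bedge v) s.
Proof.
move=> nuv.
have uS := boundary_arc triE u m1.
have : connect (dual_adj U) (bedge u) (bedge v).
  apply: (@connect_bedge (cwdist (ordS u) u).+1 (ordS u) u).
  - by [].
  - by rewrite Esym.
  - exact: node_bedge.
  - by rewrite !inE eqxx orbT.
  - by rewrite !inE eqxx.
  - by rewrite side_bedge // /seg eqxx.
  - have h : cwdist u (ordS u) = 1%N.
      by rewrite cwdist_ordS cwdistnn; case: eqP => //; lia.
    by move: h nuv; cyc u.
case/connectP=> s ps ev.
case/shortenP: ps ev => s' ps' us' _ ev.
by exists s'; apply/and3P; split=> //; rewrite ev.
Qed.

End DualTree.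

Lemma cw3_rot (m : nat) (u v w u' v' w' : 'I_m) : cw3 u v w -> cw3 u' v' w' ->
  [set u'; v'; w']%SET = [set u; v; w]%SET ->
  [\/ [/\ u' = u, v' = v & w' = w], [/\ u' = v, v' = w & w' = u] |
      [/\ u' = w, v' = u & w' = v]].
Proof.
move=> h h' e.
have : [/\ u' \in [set u; v; w]%SET, v' \in [set u; v; w]%SET &
           w' \in [set u; v; w]%SET].
  by rewrite -e !inE !eqxx ?orbT.
rewrite !inE => -[] /orP[/orP[]|] /eqP eu /orP[/orP[]|] /eqP ev
  /orP[/orP[]|] /eqP ew; subst;
  try (by exfalso; move: h h'; rewrite /cw3; lia); by [constructor 1|constructor 2|constructor 3].
Qed.

Lemma turns_card (m : nat) (x t y : {set 'I_m}) :
  turns_left x t y || turns_right x t y -> #|t| = 3%N.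
Proof.
have H (u u' w : 'I_m) : cw3 u u' w -> #|[set u; u'; w]%SET| = 3%N.
  move=> h; rewrite finset.setUC cardsU1 cards2 !inE.
  have [-> -> ->] : [/\ (w == u) = false, (w == u') = false & u != u'].
    by split; rewrite -?val_eqE /=; move: h; rewrite /cw3; lia.
  by [].
by case/orP=> /existsP[u /existsP[u' /existsP[w /and4P[h /eqP-> _ _]]]]; apply: H.
Qed.

Lemma mem_second (T : eqType) (x y : T) : x \in [:: y; x].
Proof. by rewrite !inE eqxx orbT. Qed.

Section Turns.
Variables (m : nat) (u v w : 'I_m) (x y : {set 'I_m}).
Hypothesis uvw : cw3 u v w.
Let t := [set u; v; w]%SET.

Let neqs : [/\ u != v, v != w & u != w].
Proof. by split; rewrite -val_eqE /=; move: uvw; rewrite /cw3; lia. Qed.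

Let sides_neq : [/\ [set u; v]%SET != [set v; w]%SET,
  [set v; w]%SET != [set w; u]%SET & [set w; u]%SET != [set u; v]%SET].
Proof.
have [uv vw uw] := neqs.
split; apply/eqP=> e.
- have := set21 u v; rewrite e !inE; by rewrite (negPf uv) (negPf uw).
- have := set21 v w; rewrite e !inE; by rewrite (negPf vw) eq_sym (negPf uv).
- have := set21 w u; rewrite e !inE; by rewrite ![w == _]eq_sym (negPf uw) (negPf vw).
Qed.

Lemma turns_left_exit : t :&: y = [set v; w]%SET ->
  turns_left x t y = (x :&: t == [set u; v]%SET).
Proof.
move=> ey; have [n1 n2 n3] := sides_neq; apply/idP/idP.
  case/existsP=> u' /existsP[v' /existsP[w' /and4P[h' /eqP e /eqP-> ]]].
  rewrite ey; case: (cw3_rot uvw h' (esym e)) => -[-> -> ->] //.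
    by rewrite (negPf n2).
  by rewrite eq_sym (negPf n1).
move=> /eqP ex; apply/existsP; exists u; apply/existsP; exists v.
by apply/existsP; exists w; rewrite uvw ex ey !eqxx.
Qed.

Lemma turns_right_exit : t :&: y = [set w; u]%SET ->
  turns_right x t y = (x :&: t == [set u; v]%SET).
Proof.
move=> ey; have [n1 n2 n3] := sides_neq; apply/idP/idP.
  case/existsP=> u' /existsP[v' /existsP[w' /and4P[h' /eqP e /eqP-> ]]].
  rewrite ey; case: (cw3_rot uvw h' (esym e)) => -[-> -> ->] //.
    by rewrite (negPf n3).
  by rewrite eq_sym (negPf n2).
move=> /eqP ex; apply/existsP; exists u; apply/existsP; exists v.
by apply/existsP; exists w; rewrite uvw ex ey !eqxx.
Qed.

Lemma turns_left_entry : x :&: t = [set u; v]%SET ->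
  turns_left x t y = (t :&: y == [set v; w]%SET).
Proof.
move=> ex; have [n1 n2 n3] := sides_neq; apply/idP/idP.
  case/existsP=> u' /existsP[v' /existsP[w' /and4P[h' /eqP e + /eqP->]]].
  rewrite ex; case: (cw3_rot uvw h' (esym e)) => -[-> -> ->] //.
    by rewrite (negPf n1).
  by rewrite eq_sym (negPf n3).
move=> /eqP ey; apply/existsP; exists u; apply/existsP; exists v.
by apply/existsP; exists w; rewrite uvw ex ey !eqxx.
Qed.

Lemma turns_right_entry : x :&: t = [set u; v]%SET ->
  turns_right x t y = (t :&: y == [set w; u]%SET).
Proof.
move=> ex; have [n1 n2 n3] := sides_neq; apply/idP/idP.
  case/existsP=> u' /existsP[v' /existsP[w' /and4P[h' /eqP e + /eqP->]]].
  rewrite ex; case: (cw3_rot uvw h' (esym e)) => -[-> -> ->] //.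
    by rewrite (negPf n1).
  by rewrite eq_sym (negPf n3).
move=> /eqP ey; apply/existsP; exists u; apply/existsP; exists v.
by apply/existsP; exists w; rewrite uvw ex ey !eqxx.
Qed.

End Turns.

Section Passing.
Variables (m : nat) (U : {set {set 'I_m}}).
Hypotheses (m2 : (2 < m)%N) (triU : triangulation U).

Let E := arc_rel U.
Let triE : tri_rel E := arc_rel_tri triU.
Let Eirr := tri_irr triE.
Let Esym := tri_sym triE.

Let sideN := @sideC m U m2 triU.
Let sideb := @side_bedge m U m2 triU.

(** The arc [ab] with the triangles on both sides; [a], [c], [b], [d] occur in
    clockwise order. *)
Definition quad (a c b d : 'I_m) : Prop :=
  [/\ cw3 a c b, cw3 b d a & [/\ E a b, E a c, E c b, E b d & E d a]].

Lemma quadC a c b d : quad a c b d -> quad b d a c.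
Proof. by case=> ? ? [? ? ? ? ?]; do 2 split=> //; rewrite Esym. Qed.

Section Quad.
Variables (a c b d v v' : 'I_m).
Hypotheses (abcd : quad a c b d) (nvv' : v != v').
Let t1 := [set a; c; b]%SET.
Let t2 := [set b; d; a]%SET.

Lemma side_third g h k : E g h -> cw3 g k h -> 
  node U [set g; k; h]%SET -> side g h [set g; k; h]%SET.
Proof.
move=> gh gkh nx; apply: contraT; rewrite -sideN // => sx.
have kx : k \in [set g; k; h]%SET by rewrite !inE eqxx orbT.
have := side_cseg sx kx; move: gkh; rewrite /cseg; cyc g.
Qed.

(** A path that crosses a side [gh] of the first triangle, the arc [ab] and a
    side [g'h'] of the second one separates its end leaves by [gh] and by [g'h'].
    Conversely such a path has to cross the three arcs, each exactly once, and
    as the triangles next to [ab] are visited once the crossings are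
    consecutive. *)
Lemma passing_iff g h g' h' :
  (g, h) \in [:: (c, b); (a, c)] -> (g', h') \in [:: (d, a); (b, d)] ->
  (exists2 s, dual_path U (bedge v) (bedge v') s &
     exists x y, [/\ infix [:: x; t1; t2; y] (bedge v :: s),
       x :&: t1 = [set g; h]%SET & t2 :&: y = [set g'; h']%SET]) <->
  seg g h v /\ seg g' h' v'.
Proof.
move=> gh_cases gh'_cases; have [acb bda [ab ac cb bd da]] := abcd.
have ba : E b a by rewrite Esym.
have n1 : node U t1 by apply: (node_triangle m2 triU).
have n2 : node U t2 by apply: (node_triangle m2 triU).
have gh : E g h.
  by move: gh_cases; rewrite !inE => /orP[] /eqP[-> ->].
have hg : E h g by rewrite Esym.
have gh' : E g' h'.
  by move: gh'_cases; rewrite !inE => /orP[] /eqP[-> ->].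
have hg' : E h' g' by rewrite Esym.
have s1 : side h g t1.
  move: gh_cases hg; rewrite !inE => /orP[] /eqP[-> ->] hg0.
    have e : t1 = [set b; a; c]%SET.
      by rewrite /t1 finset.setUC finset.setUA.
    rewrite e; apply: side_third; rewrite -?e //.
    by move: acb; cyc a.
  have e : t1 = [set c; b; a]%SET.
    by rewrite /t1 -finset.setUA finset.setUC.
  rewrite e; apply: side_third; rewrite -?e //.
  by move: acb; cyc a.
have s2 : side h' g' t2.
  move: gh'_cases hg'; rewrite !inE => /orP[] /eqP[-> ->] hg0.
    have e : t2 = [set a; b; d]%SET.
      by rewrite /t2 finset.setUC finset.setUA.
    rewrite e; apply: side_third; rewrite -?e //.
    by move: bda; cyc b.
  have e : t2 = [set d; a; b]%SET.
    by rewrite /t2 -finset.setUA finset.setUC.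
  rewrite e; apply: side_third; rewrite -?e //.
  by move: bda; cyc b.
have sub1 : [set g; h]%SET \subset t1.
  apply/fintype.subsetP=> z; move: gh_cases.
  by rewrite !inE => /orP[] /eqP[-> ->] /orP[] /eqP->; rewrite eqxx ?orbT.
have sub2 : [set g'; h']%SET \subset t2.
  apply/fintype.subsetP=> z; move: gh'_cases.
  by rewrite !inE => /orP[] /eqP[-> ->] /orP[] /eqP->; rewrite eqxx ?orbT.
have suba1 : [set a; b]%SET \subset t1.
  apply/fintype.subsetP=> z.
  by rewrite !inE => /orP[] /eqP->; rewrite eqxx ?orbT.
have suba2 : [set a; b]%SET \subset t2.
  apply/fintype.subsetP=> z.
  by rewrite !inE => /orP[] /eqP->; rewrite eqxx ?orbT.
split.
  case=> s ps [x [y [inf ex ey]]].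
  have [infx infy] : infix [:: x; t1] (bedge v :: s) /\
                     infix [:: t2; y] (bedge v :: s).
    case/infixP: inf => r1 [r2 e]; split; apply/infixP.
      by exists r1, (t2 :: y :: r2); rewrite e.
    by exists (r1 ++ [:: x; t1]), r2; rewrite e -catA.
  have pth : path (dual_adj U) (bedge v) s by case/and3P: ps.
  rewrite -!sideb //; split.
    have sx : side g h x.
      apply: negbNE; rewrite -(adj_side m2 triU gh (infix_path pth infx) ex) //.
      by rewrite -sideN.
    by case: (cross_once m2 triU gh ps infx ex sx).
  rewrite finset.setUC in ey.
  by case: (cross_once m2 triU hg' ps infy ey s2).
case=> sv sv'; have [s ps] := dual_path_exists m2 triU nvv'; exists s => //.
have uns : uniq (bedge v :: s) by case/and3P: ps.
have pth : path (dual_adj U) (bedge v) s by case/and3P: ps.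
have nv' := node_bedge U v'; have nv := node_bedge U v.
have sab : side a b (bedge v).
  rewrite sideb //; move: sv gh_cases; rewrite !inE => + /orP[] /eqP[eg eh];
  by subst g h; move: acb; cyc a.
have sba : side b a (bedge v').
  rewrite sideb //; move: sv' gh'_cases; rewrite !inE => + /orP[] /eqP[eg eh];
  by subst g' h'; move: bda; cyc b.
have sgh : side g h (bedge v) by rewrite sideb.
have shg : side h g (bedge v').
  rewrite sideN // sideb //; move: sba; rewrite sideb //.
  by move: gh_cases acb; rewrite !inE => /orP[] /eqP[-> ->]; cyc a.
have sgh' : side g' h' (bedge v') by rewrite sideb.
have shg' : side h' g' (bedge v).
  rewrite sideN // sideb //; move: sab; rewrite sideb //.
  by move: gh'_cases bda; rewrite !inE => /orP[] /eqP[-> ->]; cyc b.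
have [x [z [inf1 e1 sx sz]]] := cross_infix m2 triU gh ps nv' sgh shg.
have [x2 [z2 [inf2 e2 sx2 sz2]]] := cross_infix m2 triU ab ps nv' sab sba.
have [x3 [z3 [inf3 e3 sx3 sz3]]] := cross_infix m2 triU hg' ps nv' shg' sgh'.
have [_ nz _ _] := adj_nodes (infix_path pth inf1).
have [nx2 nz2 _ _] := adj_nodes (infix_path pth inf2).
have [nx3 _ _ _] := adj_nodes (infix_path pth inf3).
have ez : z = t1.
  apply: (side_uniq m2 triU hg) => //; last by rewrite finset.setUC.
  by rewrite finset.setUC -e1 finset.subsetIr.
have ex2 : x2 = t1.
  apply: (side_uniq m2 triU ab) => //; first by rewrite -e2 finset.subsetIl.
  exact: side_third.
have ez2 : z2 = t2.
  apply: (side_uniq m2 triU ba) => //.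
  - by rewrite finset.setUC -e2 finset.subsetIr.
  - by rewrite finset.setUC.
  exact: side_third.
have ex3 : x3 = t2.
  apply: (side_uniq m2 triU hg') => //; first by rewrite -e3 finset.subsetIl.
  by rewrite finset.setUC.
subst z x2 z2 x3; exists x, z3; split=> //; last by rewrite finset.setUC.
have inf12 : infix [:: x; t1; t2] (bedge v :: s).
  exact: (infix_glue (u := [:: x]) (v := [:: t2]) uns inf1 inf2).
exact: (infix_glue (u := [:: x; t1]) (v := [:: z3]) uns inf12 inf3).
Qed.

End Quad.
Section Signs.
Variables (a c b d v v' : 'I_m).
Hypotheses (abcd : quad a c b d) (nvv' : v != v').

Definition passes_arc (f : {set 'I_m})
    (turn1 turn2 : {set 'I_m} -> {set 'I_m} -> {set 'I_m} -> bool) : Prop :=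
  exists2 s, dual_path U (bedge v) (bedge v') s &
    exists x t1 t2 y,
      [/\ infix [:: x; t1; t2; y] (bedge v :: s), t1 :&: t2 = f,
          turn1 x t1 t2 & turn2 t1 t2 y].

Lemma passes_arc_nodes turn1 turn2 : passes_arc [set a; b]%SET turn1 turn2 ->
  (forall x t y, turn1 x t y -> #|t| = 3%N) ->
  (forall x t y, turn2 x t y -> #|t| = 3%N) ->
  exists2 s, dual_path U (bedge v) (bedge v') s &
    exists x t1 t2 y,
      [/\ infix [:: x; t1; t2; y] (bedge v :: s), t1 :&: t2 = [set a; b]%SET,
          turn1 x t1 t2, turn2 t1 t2 y &
        (t1 = [set a; c; b] /\ t2 = [set b; d; a] \/
         t1 = [set b; d; a] /\ t2 = [set a; c; b])%SET].
Proof.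
have [acb bda [ab ac cb bd da]] := abcd.
case=> s ps [x [t1 [t2 [y [inf e h1 h2]]]]] c1 c2.
exists s => //; exists x, t1, t2, y; split=> //.
have pth : path (dual_adj U) (bedge v) s by case/and3P: ps.
have inf' : infix [:: t1; t2] (bedge v :: s).
  case/infixP: inf => r1 [r2 e']; apply/infixP.
  by exists (r1 ++ [:: x]), (y :: r2); rewrite e' -catA.
have adj := infix_path pth inf'; have [n1 n2 _ _] := adj_nodes adj.
have ba : E b a by rewrite Esym.
have third g h k t : E g h -> E g k -> E k h -> cw3 g k h -> node U t ->
    [set g; h]%SET \subset t -> side g h t -> #|t| = 3%N ->
    t = [set g; k; h]%SET.
  move=> gh gk kh gkh nt /fintype.subsetP sub st c3.
  have [||[et _]|[k' [gkh' gk' kh' ->]]] := node_side m2 triU gh nt _ _ st.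
  - by apply: sub; rewrite set21.
  - by apply: sub; rewrite set22.
  - by move: c3; rewrite et cards2; case: (g != h).
  by rewrite (third_vertex_uniq triE gkh gkh').
have sub1 : [set a; b]%SET \subset t1 by rewrite -e finset.subsetIl.
have sub2 : [set a; b]%SET \subset t2 by rewrite -e finset.subsetIr.
have sub1' : [set b; a]%SET \subset t1 by rewrite finset.setUC.
have sub2' : [set b; a]%SET \subset t2 by rewrite finset.setUC.
have [s1|s1] := boolP (side a b t1).
  have s2 : side b a t2 by rewrite sideN // (adj_side m2 triU ab adj e) s1.
  left; split; apply: third => //; [exact: c1 h1|exact: c2 h2].
have s2 : side a b t2 by rewrite (adj_side m2 triU ab adj e).
rewrite -sideN // in s1.
right; split; apply: third => //; [exact: c1 h1|exact: c2 h2].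
Qed.

End Signs.

(** Entering the triangle [acb] through [cb] and leaving through [ab] is a left
    turn, then leaving [bda] through [da] is a right turn; coming from the
    other side of [ab] exchanges the two triangles. *)
Lemma passes_left_right a c b d v v' : quad a c b d -> v != v' ->
  passes_arc v v' [set a; b]%SET (@turns_left m) (@turns_right m) <->
  (seg c b v /\ seg d a v') \/ (seg d a v /\ seg c b v').
Proof.
move=> q nvv'; have q' := quadC q.
have [acb bda [ab ac cb bd da]] := q.
have cba : cw3 c b a by move: acb; cyc a.
have dab : cw3 d a b by move: bda; cyc a.
have abd : cw3 a b d by move: bda; cyc a.
have bac : cw3 b a c by move: acb; cyc a.
have e1 : [set a; c; b]%SET = [set c; b; a]%SET :> {set 'I_m}.
  by rewrite -finset.setUA finset.setUC.
have e2 : [set b; d; a]%SET = [set a; b; d]%SET :> {set 'I_m}.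
  by rewrite finset.setUC finset.setUA.
have e1' : [set a; c; b]%SET = [set b; a; c]%SET :> {set 'I_m}.
  by rewrite finset.setUC finset.setUA.
have e2' : [set b; d; a]%SET = [set d; a; b]%SET :> {set 'I_m}.
  by rewrite -finset.setUA finset.setUC.
have i12 : [set a; c; b] :&: [set b; d; a] = [set a; b] :> {set 'I_m}.
  apply/setP=> z; rewrite !inE; move: acb bda; cyc a.
have i21 : [set b; d; a] :&: [set a; c; b] = [set b; a] :> {set 'I_m}.
  by rewrite finset.setIC i12 finset.setUC.
split.
  move=> /(passes_arc_nodes q)[x t y h|x t y h|s ps].
  - by apply: (@turns_card _ x t y); rewrite h.
  - by apply: (@turns_card _ x t y); rewrite h orbT.
  case=> x [t1 [t2 [y [inf _ h1 h2 [] [et1 et2]]]]]; subst t1 t2; [left|right].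
    apply/(passing_iff q nvv' (mem_head _ _) (mem_head _ _)).
    exists s => //; exists x, y; split=> //.
      apply/eqP; rewrite e1 -(@turns_left_exit _ c b a x [set b; d; a]) //.
        by rewrite -e1.
      by rewrite -e1 i12 finset.setUC.
    apply/eqP; rewrite e2 -(@turns_right_entry _ a b d [set a; c; b]) //.
      by rewrite -e2.
    by rewrite -e2 i12.
  apply/(passing_iff q' nvv' (mem_head _ _) (mem_head _ _)).
  exists s => //; exists x, y; split=> //.
    apply/eqP; rewrite e2' -(@turns_left_exit _ d a b x [set a; c; b]) //.
      by rewrite -e2'.
    by rewrite -e2' i21 finset.setUC.
  apply/eqP; rewrite e1' -(@turns_right_entry _ b a c [set b; d; a]) //.
    by rewrite -e1'.
  by rewrite -e1' i21.
case.
  case/(passing_iff q nvv' (mem_head _ _) (mem_head _ _))=> s ps [x [y [inf ex ey]]].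
  exists s => //; exists x, [set a; c; b]%SET, [set b; d; a]%SET, y; split=> //.
    rewrite {1}e1 turns_left_exit //; last by rewrite -e1 i12 finset.setUC.
    by rewrite -e1 ex.
  rewrite {1}e2 turns_right_entry //; last by rewrite -e2 i12.
  by rewrite -e2 ey.
case/(passing_iff q' nvv' (mem_head _ _) (mem_head _ _))=> s ps [x [y [inf ex ey]]].
exists s => //; exists x, [set b; d; a]%SET, [set a; c; b]%SET, y; split=> //.
- by rewrite i21 finset.setUC.
- rewrite {1}e2' turns_left_exit //; last by rewrite -e2' i21 finset.setUC.
  by rewrite -e2' ex.
rewrite {1}e1' turns_right_entry //; last by rewrite -e1' i21.
by rewrite -e1' ey.
Qed.

Lemma passes_right_left a c b d v v' : quad a c b d -> v != v' ->
  passes_arc v v' [set a; b]%SET (@turns_right m) (@turns_left m) <->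
  (seg a c v /\ seg b d v') \/ (seg b d v /\ seg a c v').
Proof.
move=> q nvv'; have q' := quadC q.
have [acb bda [ab ac cb bd da]] := q.
have abd : cw3 a b d by move: bda; cyc a.
have bac : cw3 b a c by move: acb; cyc a.
have e2 : [set b; d; a]%SET = [set a; b; d]%SET :> {set 'I_m}.
  by rewrite finset.setUC finset.setUA.
have e1' : [set a; c; b]%SET = [set b; a; c]%SET :> {set 'I_m}.
  by rewrite finset.setUC finset.setUA.
have i12 : [set a; c; b] :&: [set b; d; a] = [set a; b] :> {set 'I_m}.
  apply/setP=> z; rewrite !inE; move: acb bda; cyc a.
have i21 : [set b; d; a] :&: [set a; c; b] = [set b; a] :> {set 'I_m}.
  by rewrite finset.setIC i12 finset.setUC.
split.
  move=> /(passes_arc_nodes q)[x t y h|x t y h|s ps].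
  - by apply: (@turns_card _ x t y); rewrite h orbT.
  - by apply: (@turns_card _ x t y); rewrite h.
  case=> x [t1 [t2 [y [inf _ h1 h2 [] [et1 et2]]]]]; subst t1 t2; [left|right].
    apply/(passing_iff q nvv' (mem_second _ _) (mem_second _ _)).
    exists s => //; exists x, y; split=> //.
      apply/eqP; rewrite -(@turns_right_exit _ a c b x [set b; d; a]) //.
      by rewrite i12 finset.setUC.
    apply/eqP; rewrite e2 -(@turns_left_entry _ a b d [set a; c; b]) //.
      by rewrite -e2.
    by rewrite -e2 i12.
  apply/(passing_iff q' nvv' (mem_second _ _) (mem_second _ _)).
  exists s => //; exists x, y; split=> //.
    apply/eqP; rewrite -(@turns_right_exit _ b d a x [set a; c; b]) //.
    by rewrite i21 finset.setUC.
  apply/eqP; rewrite e1' -(@turns_left_entry _ b a c [set b; d; a]) //.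
    by rewrite -e1'.
  by rewrite -e1' i21.
case.
  case/(passing_iff q nvv' (mem_second _ _) (mem_second _ _))=> s ps [x [y [inf ex ey]]].
  exists s => //; exists x, [set a; c; b]%SET, [set b; d; a]%SET, y; split=> //.
    rewrite turns_right_exit ?ex //; by rewrite i12 finset.setUC.
  rewrite {1}e2 turns_left_entry //; last by rewrite -e2 i12.
  by rewrite -e2 ey.
case/(passing_iff q' nvv' (mem_second _ _) (mem_second _ _))=> s ps [x [y [inf ex ey]]].
exists s => //; exists x, [set b; d; a]%SET, [set a; c; b]%SET, y; split=> //.
- by rewrite i21 finset.setUC.
- rewrite turns_right_exit ?ex //; by rewrite i21 finset.setUC.
rewrite {1}e1' turns_left_entry //; last by rewrite -e1' i21.
by rewrite -e1' ey.
Qed.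

End Passing.

(** * The extended triangulation of the doubled polygon *)

Section DoubledPolygon.
Variable n : nat.

Lemma old_vertex_inj : injective (@old_vertex n).
Proof. by move=> a b /(congr1 val) /= e; apply: val_inj; rewrite /=; lia. Qed.

Lemma ordS_new (i : 'I_n) : ordS (new_vertex i) = old_vertex i.
Proof.
by apply: val_inj; rewrite /= modn_small //; have := ltn_ord i; rewrite -!addnn; lia.
Qed.

Variant vertex_spec : 'I_(n.*2) -> Type :=
  | OldVertex a : vertex_spec (old_vertex a)
  | NewVertex i : vertex_spec (new_vertex i).

Lemma vertexP x : vertex_spec x.
Proof.
have hx : (x./2 < n)%N by rewrite ltn_half_double.
have e := odd_double_half x.
case ox : (odd x) e => /= e.
  have -> : x = old_vertex (Ordinal hx) by apply: val_inj => /=; lia.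
  by constructor.
have -> : x = new_vertex (Ordinal hx) by apply: val_inj => /=; lia.
by constructor.
Qed.

Lemma old_new_neq (a i : 'I_n) : (old_vertex a == new_vertex i) = false.
Proof. by apply/eqP => /(congr1 val) /=; lia. Qed.

Lemma new_old_neq (a i : 'I_n) : new_vertex i = old_vertex a -> False.
Proof. by move/(congr1 val) => /=; lia. Qed.

Lemma old_arc2 (a b : 'I_n) : old_arc [set a; b]%SET = [set old_vertex a; old_vertex b]%SET.
Proof. by rewrite /old_arc imsetU1 imset_set1. Qed.

Lemma cw3_old (a b c : 'I_n) : cw3 (old_vertex a) (old_vertex b) (old_vertex c) = cw3 a b c.
Proof. by rewrite /cw3 /= -!addnn; lia. Qed.

Lemma crosses_old (a b c d : 'I_n) :
  crosses (old_vertex a) (old_vertex b) (old_vertex c) (old_vertex d) =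
  crosses a b c d.
Proof. by rewrite /crosses !cw4_cw3 !cw3_old. Qed.

Lemma leaf_bedge (i : 'I_n) : leaf i = bedge (new_vertex i).
Proof. by rewrite /leaf /bedge ordS_new. Qed.

Lemma new_vertex_inj : injective (@new_vertex n).
Proof. by move=> a b /(congr1 val) /= e; apply: val_inj; rewrite /=; lia. Qed.

Lemma val_ord_pred (i : 'I_n) : ord_pred i = (if (i == 0 :> nat)%N then n.-1 else i.-1) :> nat.
Proof.
have hi := ltn_ord i; rewrite /=; case: eqP => [->|h].
  by rewrite add0n modn_small //; lia.
have -> : (i + n).-1 = (i.-1 + n)%N by lia.
by rewrite modnDr modn_small //; lia.
Qed.

Hypothesis n2 : (2 < n)%N.

Lemma doubled_gt2 : (2 < n.*2)%N. Proof. by rewrite -addnn; lia. Qed.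

Lemma ordS_old_pred (i : 'I_n) : ordS (old_vertex (ord_pred i)) = new_vertex i.
Proof.
apply: val_inj => /=; rewrite -[((i + n).-1 %% n)%N]/(nat_of_ord (ord_pred i)).
rewrite val_ord_pred; have := ltn_ord i; case: eqP => [-> h|h hi].
  have -> : n.-1.*2.+2 = (n.*2)%N by rewrite -!addnn; lia.
  by rewrite modnn.
by rewrite modn_small; rewrite -!addnn; lia.
Qed.

End DoubledPolygon.

Section Hat.
Variables (n : nat) (T : {set {set 'I_n}}).
Hypotheses (n2 : (2 < n)%N) (triT : triangulation T).

Let E := arc_rel T.
Let triE : tri_rel E := arc_rel_tri triT.
Let n1 : (1 < n)%N := ltnW n2.
Let Eirr := tri_irr triE.
Let Esym := tri_sym triE.
Let Enc := tri_nc triE.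
Let E2 := arc_rel (hat T).

Let m2 := doubled_gt2 n2.
Let m1 : (1 < n.*2)%N := ltnW m2.

Lemma hat_old a b : E2 (old_vertex a) (old_vertex b) = E a b.
Proof.
rewrite /E2 /E /arc_rel /hat !inE -old_arc2.
have new_notin (i : 'I_n) e : new_vertex i \notin old_arc e.
  by apply/imsetP=> -[a' _ h]; case: (new_old_neq h).
have nleaf' : old_arc [set a; b]%SET \notin [set leaf' i | i : 'I_n]%SET.
  apply/imsetP=> -[i _ e]; have := new_notin i [set a; b]%SET.
  by rewrite e !inE eqxx orbT.
have nleaf : old_arc [set a; b]%SET \notin [set leaf i | i : 'I_n]%SET.
  apply/imsetP=> -[i _ e]; have := new_notin i [set a; b]%SET.
  by rewrite e !inE eqxx.
rewrite (negPf nleaf) (negPf nleaf') !orbF.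
by apply: finset.mem_imset; apply: imset_inj; apply: old_vertex_inj.
Qed.

Lemma hatP x y : E2 x y ->
  (exists a b, [/\ x = old_vertex a, y = old_vertex b & E a b]) \/
  y = ordS x \/ x = ordS y.
Proof.
move=> h; case: (vertexP x) h => [a|i]; case: (vertexP y) => [b|j].
- by rewrite hat_old => ab; left; exists a, b.
- rewrite /E2 /arc_rel /hat !inE => /orP[/orP[]|] /imsetP[i _].
  + move=> e; have : new_vertex j \in old_arc i by rewrite -e !inE eqxx orbT.
    by case/imsetP=> c _ h; case: (new_old_neq h).
  + case/set2_eq=> -[] h h'; try (by case: (new_old_neq h)); try (by case: (new_old_neq (esym h)));
    by right; left; rewrite h h' (ordS_old_pred n2).
  case/set2_eq=> -[] h h'; try (by case: (new_old_neq h)); try (by case: (new_old_neq (esym h)));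
    by right; right; rewrite h h' ordS_new.
- rewrite /E2 /arc_rel /hat !inE => /orP[/orP[]|] /imsetP[k _].
  + move=> e; have : new_vertex i \in old_arc k by rewrite -e !inE eqxx.
    by case/imsetP=> c _ h; case: (new_old_neq h).
  + case/set2_eq=> -[] h h'; try (by case: (new_old_neq h)); try (by case: (new_old_neq (esym h)));
    by right; right; rewrite h h' (ordS_old_pred n2).
  case/set2_eq=> -[] h h'; try (by case: (new_old_neq h)); try (by case: (new_old_neq (esym h)));
    by right; left; rewrite h h' ordS_new.
rewrite /E2 /arc_rel /hat !inE => /orP[/orP[]|] /imsetP[k _].
- move=> e; have : new_vertex i \in old_arc k by rewrite -e !inE eqxx.
  by case/imsetP=> c _ h; case: (new_old_neq h).
- move=> e; have : old_vertex (ord_pred k) \in [set new_vertex i; new_vertex j]%SET.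
    by rewrite e !inE eqxx.
  by rewrite !inE !old_new_neq.
move=> e; have : old_vertex k \in [set new_vertex i; new_vertex j]%SET.
  by rewrite e !inE eqxx orbT.
by rewrite !inE !old_new_neq.
Qed.

Lemma hat_old_new i : E2 (new_vertex i) (old_vertex i) /\
  E2 (old_vertex (ord_pred i)) (new_vertex i).
Proof.
rewrite /E2 /arc_rel /hat !inE; split; apply/orP; [right|left; apply/orP; right].
  by apply/imsetP; exists i.
by apply/imsetP; exists i.
Qed.

Lemma hat_old_new_eq a i :
  E2 (old_vertex a) (new_vertex i) -> a = i \/ a = ord_pred i.
Proof.
have [e1 e2] := hat_old_new i.
case/hatP=> [[? [? [_ h]]]|[]]; first by case: (new_old_neq h).
- by rewrite -(ordS_old_pred n2) => /ordS_inj/old_vertex_inj->; right.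
by rewrite ordS_new => /old_vertex_inj->; left.
Qed.

Lemma ordS_pred_arc i : E (ord_pred i) i.
Proof. by rewrite -{2}(ord_predK i); apply: boundary_arc. Qed.

(** A new vertex [i'] is cut off by the old boundary edge next to it, which
    every arc at [i'] crosses except the two glued edges.  So maximality only has
    to be checked between old vertices, where it is inherited. *)
Lemma hat_triangulation : triangulation (hat T).
Proof.
have E2sym a b : E2 a b = E2 b a by rewrite /E2 /arc_rel finset.setUC.
have nbd (x z t : 'I_(n.*2)) : ~~ crosses x (ordS x) z t.
  have : cwdist x (ordS x) = 1%N by rewrite cwdist_ordS cwdistnn; case: eqP => //; lia.
  cyc x.
have crossC (x y z t : 'I_(n.*2)) : crosses x y z t = crosses y x z t.
  by rewrite /crosses /cw4; lia.
have crossC2 (x y z t : 'I_(n.*2)) : crosses x y z t = crosses z t x y.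
  by rewrite /crosses /cw4; lia.
apply: tri_rel_triangulation.
  move=> e; rewrite !inE => /orP[/orP[]|] /imsetP[i iT ->].
  - have /andP[/forall_inP/(_ _ iT)/cards2P[a [b [_ ->]]] _] := maxsetp triT.
    by exists (old_vertex a), (old_vertex b); rewrite old_arc2.
  - by eexists _, _.
  by eexists _, _.
split=> //.
- move=> x y /hatP[[a [b [-> -> /Eirr]]]|[->|->]].
  + by apply: contra_neq => /old_vertex_inj.
  + by rewrite eq_sym ordS_neq.
  by rewrite ordS_neq.
- move=> x y z t xz yt; have := xz; have := yt.
  move=> /hatP[[a [b [-> -> ab]]]|[->|->]]; last 2 first.
  + by move=> _; rewrite crossC2.
  + by move=> _; rewrite crossC2 crossC.
  move=> /hatP[[a' [b' [-> -> ab']]]|[->|->]]; last 2 first.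
  + by [].
  + by rewrite crossC.
  by rewrite crosses_old; apply: Enc.
have new_max i z : new_vertex i != z ->
    (forall b d, E2 b d -> ~~ crosses (new_vertex i) z b d) ->
    E2 (new_vertex i) z.
  move=> niz h; have [e1 e2] := hat_old_new i.
  have [->|zo] := eqVneq z (old_vertex i); first by [].
  have [->|zp] := eqVneq z (old_vertex (ord_pred i)); first by rewrite E2sym.
  have := h (old_vertex (ord_pred i)) (old_vertex i).
  rewrite hat_old ordS_pred_arc => /(_ isT).
  have := ordS_old_pred n2 i; have := ordS_new i.
  set p := old_vertex (ord_pred i) in zp *; move=> o_def n_def.
  have t1 : cwdist p (new_vertex i) = 1%N.
    by rewrite -n_def cwdist_ordS cwdistnn; case: eqP => //; lia.
  have t2 : cwdist p (old_vertex i) = 2%N.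
    by rewrite -o_def cwdist_ordS t1; have := m2; case: eqP => //; lia.
  by move: t1 t2 niz zo zp; cyc p.
move=> x y; case: (vertexP x) => [a|i]; last exact: new_max.
case: (vertexP y) => [b|j]; last first.
  move=> naj h; rewrite -/E2 E2sym; apply: new_max; first by rewrite eq_sym.
  by move=> b d bd; rewrite crossC; apply: h.
move=> nab h; rewrite -/E2 hat_old; case: triE => _ _ _; apply.
  by apply: contra_neq nab => ->.
by move=> b' d' bd; rewrite -crosses_old; apply: h; rewrite -/E2 hat_old.
Qed.

End Hat.

(** * Crossing numbers and g-vectors *)

(** Whether the arc from [i] to [j], moved slightly counterclockwise off its
    end points, crosses the arc from [a] to [b]. *)
Definition chi (n : nat) (a b i j : 'I_n) : bool :=
  ((i <= a)%N (+) (i <= b)%N) (+) ((j <= a)%N (+) (j <= b)%N).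

Section GVector.
Variables (n : nat) (T : {set {set 'I_n}}).
Hypotheses (n2 : (2 < n)%N) (triT : triangulation T).

Let E := arc_rel T.
Let triE : tri_rel E := arc_rel_tri triT.
Let n1 : (1 < n)%N := ltnW n2.
Let Eirr := tri_irr triE.
Let Esym := tri_sym triE.
Let E2 := arc_rel (hat T).
Let triH := hat_triangulation n2 triT.
Let triE2 : tri_rel E2 := arc_rel_tri triH.
Let m2 := doubled_gt2 n2.

Definition seg_cross (m : nat) (g h v v' : 'I_m) : int :=
  (seg g h v (+) seg g h v')%:R.

Lemma passesE turn1 turn2 i j e :
  passes T turn1 turn2 i j e <->
  passes_arc (hat T) (new_vertex i) (new_vertex j) (old_arc e) turn1 turn2.
Proof. by rewrite /passes /passes_arc -!leaf_bedge. Qed.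

(** The sides of the quadrilateral cut the leaves into four parts.  Both sides
    of the identity vanish unless the end leaves lie in opposite parts. *)
Lemma sigma_seg a b c d i j : i != j ->
  quad (hat T) (old_vertex a) c (old_vertex b) d ->
  sigma T i j [set a; b]%SET *+ 2 =
    let X g h := seg_cross g h (new_vertex i) (new_vertex j) in
    X c (old_vertex b) + X d (old_vertex a) - X (old_vertex a) c
    - X (old_vertex b) d.
Proof.
move=> nij q /=; have nv : new_vertex i != new_vertex j.
  by apply: contra_neq nij => /new_vertex_inj.
have [acb bda _] := q; rewrite /sigma /seg_cross.
set A := old_vertex a in q acb bda *; set B := old_vertex b in q acb bda *.
have eAB : old_arc [set a; b]%SET = [set A; B]%SET by rewrite old_arc2.
have LR : `[< passes T (@turns_left n.*2) (@turns_right n.*2) i j [set a; b]%SET >] =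
   (seg c B (new_vertex i) && seg d A (new_vertex j)) ||
   (seg d A (new_vertex i) && seg c B (new_vertex j)).
  have H := passes_left_right m2 triH q nv; rewrite -eAB -passesE in H.
  apply/asboolP/idP => [/H[]|/orP h]; first by case=> -> ->.
    by case=> -> ->; rewrite orbT.
  by apply/H; case: h => /andP[]; [left|right].
have RL : `[< passes T (@turns_right n.*2) (@turns_left n.*2) i j [set a; b]%SET >] =
   (seg A c (new_vertex i) && seg B d (new_vertex j)) ||
   (seg B d (new_vertex i) && seg A c (new_vertex j)).
  have H := passes_right_left m2 triH q nv; rewrite -eAB -passesE in H.
  apply/asboolP/idP => [/H[]|/orP h]; first by case=> -> ->.
    by case=> -> ->; rewrite orbT.
  by apply/H; case: h => /andP[]; [left|right].
rewrite LR RL.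
have part v : [|| [&& seg A c v, ~~ seg c B v, ~~ seg B d v & ~~ seg d A v],
    [&& ~~ seg A c v, seg c B v, ~~ seg B d v & ~~ seg d A v],
    [&& ~~ seg A c v, ~~ seg c B v, seg B d v & ~~ seg d A v] |
    [&& ~~ seg A c v, ~~ seg c B v, ~~ seg B d v & seg d A v]].
  by move: acb bda; cyc A.
move: (part (new_vertex i)) (part (new_vertex j)).
by case: (seg A c (new_vertex i)); case: (seg c B (new_vertex i));
   case: (seg B d (new_vertex i)); case: (seg d A (new_vertex i));
   case: (seg A c (new_vertex j)); case: (seg c B (new_vertex j));
   case: (seg B d (new_vertex j)); case: (seg d A (new_vertex j)).
Qed.

(** The contribution of the side of the arc from [a] to [b] that lies
    clockwise from [a]; when [ab] is a boundary edge this side is the triangle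
    glued to it. *)
Definition corner (a b i j : 'I_n) : int :=
  \sum_(c | [&& cw3 a c b, E a c & E c b])
     ((chi c b i j)%:R - (chi a c i j)%:R)
  + (if b == ordS a then (i == b)%:R + (j == b)%:R else 0).

Lemma seg_cross_old (a b i j : 'I_n) : a != b ->
  seg_cross (old_vertex a) (old_vertex b) (new_vertex i) (new_vertex j) =
  (chi a b i j)%:R.
Proof.
rewrite -val_eqE /= => nab; rewrite /seg_cross; congr (nat_of_bool _)%:R.
rewrite /seg /chi /cw3 -!val_eqE /= -!addnn.
have H (k : 'I_n) : [|| (k + k == (a + a).+1)%N,
    ((a + a).+1 < k + k < (b + b).+1)%N, (k + k < (b + b).+1 < (a + a).+1)%N
    | ((b + b).+1 < (a + a).+1 < k + k)%N] =
    (((k <= a)%N (+) (k <= b)%N) (+) (b < a)%N).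
  by case: (ltngtP a b) nab => // h _; rewrite ?addbF ?addbT;
     case: (leqP k a); case: (leqP k b) => /=; lia.
rewrite !H; by case: (_ <= _)%N; case: (_ <= _)%N; case: (_ < _)%N;
 case: (_ <= _)%N; case: (_ <= _)%N.
Qed.

(** Behind a boundary edge lies a glued triangle.  One of its two new sides is
    crossed by no path between leaves [i], the other one is the leaf [b]. *)
Lemma corner_hat a b : E a b -> exists c,
  [/\ cw3 (old_vertex a) c (old_vertex b), E2 (old_vertex a) c,
      E2 c (old_vertex b) &
      forall i j, i != j -> corner a b i j =
        seg_cross c (old_vertex b) (new_vertex i) (new_vertex j) -
        seg_cross (old_vertex a) c (new_vertex i) (new_vertex j)].
Proof.
move=> ab; have nab := Eirr ab.
have AB : E2 (old_vertex a) (old_vertex b) by rewrite /E2 hat_old.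
have bet : cw3 (old_vertex a) (ordS (old_vertex a)) (old_vertex b).
  have t1 : cwdist (old_vertex a) (ordS (old_vertex a)) = 1%N.
    by rewrite cwdist_ordS cwdistnn; case: eqP => //; lia.
  have : (1 < cwdist (old_vertex a) (old_vertex b))%N.
    move: nab; rewrite -val_eqE /cwdist /=; have := ltn_ord a; have := ltn_ord b.
    by case: (leqP (a.*2.+1) (b.*2.+1)); rewrite -!addnn; lia.
  by move: t1; cyc (old_vertex a).
have [c [acb ac cb]] := third_vertex triE2 AB bet.
exists c; split=> // i j nij; rewrite /corner.
case: (vertexP c) acb ac cb => [c0|k] acb ac cb.
  rewrite /E2 !hat_old // in ac cb; rewrite cw3_old in acb.
  rewrite !seg_cross_old ?Eirr // (big_pred1 c0).
    case: eqP => [e|_]; last by rewrite addr0.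
    have : cwdist a b = 1%N by rewrite e cwdist_ordS cwdistnn; case: eqP => //; lia.
    by move: acb; cyc a.
  move=> c1 /=; apply/and3P/eqP=> [[h1 h2 h3]|-> //].
  exact: (third_vertex_uniq triE h1 acb).
have cb' : E2 (old_vertex b) (new_vertex k) by rewrite /E2 /arc_rel finset.setUC.
have [p [ep pk]] : exists p, p = ord_pred k /\
    (k = 0%N :> nat /\ p.+1 = n \/ p.+1 = k :> nat).
  exists (ord_pred k); split=> //; rewrite (val_ord_pred k).
  by move: (ltn_ord k); clear; case: eqP; lia.
have hk := ltn_ord k.
have [ea eb] : a = p /\ b = k.
  rewrite ep; case: (hat_old_new_eq n2 ac) => ea; case: (hat_old_new_eq n2 cb') => eb;
    move: nab acb; rewrite ea eb ?eqxx // => _.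
  by rewrite -ep /cw3 /= -!addnn; clear -pk hk; lia.
rewrite ea eb ep ord_predK -ep eqxx big_pred0 ?add0r; last first.
  move=> c0; apply/negbTE/negP=> /and3P[+ _ _].
  by rewrite /cw3; have := ltn_ord c0; clear -pk hk; lia.
have H1 (i0 : 'I_n) : seg (new_vertex k) (old_vertex k) (new_vertex i0) = (i0 == k).
  rewrite -[RHS]val_eqE /seg -[new_vertex i0 == _]val_eqE /cw3 /=.
  by rewrite -!addnn; clear; lia.
have H2 (i0 : 'I_n) : seg (old_vertex p) (new_vertex k) (new_vertex i0) = false.
  rewrite /seg -val_eqE /cw3 /=; have := ltn_ord i0.
  by rewrite -!addnn; clear -pk hk; lia.
rewrite /seg_cross !H1 !H2 subr0.
case: eqP => [ei|_]; case: eqP => [ej|_] //.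
by move: nij; rewrite ei ej eqxx.
Qed.

(** Shear coordinates are sums of two local contributions, one from each side
    of the arc. *)
Lemma sigma_corner a b i j : i != j -> E a b ->
  sigma T i j [set a; b]%SET *+ 2 = corner a b i j + corner b a i j.
Proof.
move=> nij ab; have ba : E b a by rewrite Esym.
have [c [acb ac cb ->//]] := corner_hat ab.
have [d [bda bd da ->//]] := corner_hat ba.
have AB : E2 (old_vertex a) (old_vertex b) by rewrite /E2 hat_old.
rewrite (sigma_seg nij (c := c) (d := d)) //=.
by rewrite -!addrA; congr (_ + _); rewrite addrCA addrC -addrA.
Qed.
End GVector.

(** * The weight vector as a tree metric *)

Lemma sum_rot (V : nmodType) (I : finType) (F : I -> I -> I -> V) :
  \sum_a \sum_b \sum_c F a b c = \sum_a \sum_b \sum_c F c a b.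
Proof.
under [RHS]eq_bigr => a _ do rewrite exchange_big /=.
by rewrite [RHS]exchange_big.
Qed.

Section Weight.
Variables (R : realType) (n : nat) (T : {set {set 'I_n}}).
Hypotheses (n2 : (2 < n)%N) (triT : triangulation T).
Variable wT : {linear arc_space R T -> R^o}.

Let E := arc_rel T.
Let triE : tri_rel E := arc_rel_tri triT.
Let Eirr := tri_irr triE.
Let Esym := tri_sym triE.

Let W (a b : 'I_n) : R := wT (arc_basis R T [set a; b]%SET).
Let WC a b : W a b = W b a. Proof. by rewrite /W finset.setUC. Qed.

Lemma weight_vectorE ij : weight_vector wT ij =
  \sum_(e in T) (sigma T (val ij).1 (val ij).2 e)%:~R * wT (arc_basis R T e).
Proof.
rewrite /weight_vector; set g := [ffun e => _].
have -> : g = \sum_(e in T)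
    (sigma T (val ij).1 (val ij).2 e)%:~R *: arc_basis R T e :> arc_space R T.
  apply/ffunP=> e0; rewrite ffunE sum_ffunE /gvec sum_ffunE rmorph_sum /=.
  apply: eq_bigr => e eT; rewrite !ffunE.
  rewrite /GRing.scale /= rmorphM /=; congr (_ * _).
  by case: (_ == _).
by rewrite linear_sum; apply: eq_bigr => e _; rewrite linearZ.
Qed.

Lemma sum_arcs (F : {set 'I_n} -> R) :
  \sum_a \sum_(b | E a b) F [set a; b]%SET = (\sum_(e in T) F e) *+ 2.
Proof.
rewrite pair_big_dep /= (partition_big (fun p => [set p.1; p.2]%SET) (mem T)) //=.
rewrite -sumrMnl; apply: eq_bigr => e eT.
have /andP[/forall_inP/(_ _ eT)/cards2P[x [y [nxy ee]]] _] := maxsetp triT.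
rewrite (eq_bigr (fun=> F e)) => [|p /andP[_ /eqP-> //]].
rewrite sumr_const; congr (_ *+ _).
rewrite (_ : #|_| = #|[set (x, y); (y, x)]%SET|).
  by rewrite cards2 xpair_eqE (negPf nxy).
apply: eq_card => -[p q]; rewrite !inE /= /E /arc_rel.
apply/andP/orP=> [[_ /eqP]|]; last first.
  by case=> /eqP[-> ->]; rewrite ee ?[[set y; x]%SET]finset.setUC -ee eT eqxx.
rewrite ee => ep; have := set21 x y; have := set22 x y; have := set21 p q; have := set22 p q.
rewrite ep -{3 4}ep !inE.
by do 4 (case/orP=> /eqP ?); subst; rewrite ?eqxx ?(negPf nxy) //; auto;
  move: nxy; rewrite eqxx.
Qed.

Let t (a c b : 'I_n) : bool := [&& cw3 a c b, E a b, E a c & E c b].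
Let t_rot a c b : t c b a = t a c b.
Proof.
rewrite /t (Esym c a) (Esym b a); have -> : cw3 c b a = cw3 a c b by cyc a.
by case: (cw3 _ _ _); case: (E a b); case: (E a c); case: (E c b).
Qed.

Let Y a b : R := \sum_(c | [&& cw3 a c b, E a c & E c b]) (W a c - W c b).

(** Summation by parts: every triangle contributes an expression that is
    antisymmetric under exchange of the two functions on its sides, up to
    rotation. *)
Lemma sum_triangles (X : 'I_n -> 'I_n -> R) : (forall a b, X a b = X b a) ->
  \sum_a \sum_(b | E a b)
     W a b * \sum_(c | [&& cw3 a c b, E a c & E c b]) (X c b - X a c) =
  \sum_a \sum_(b | E a b) X a b * Y a b.
Proof.
move=> XC.
have unfold (F G : 'I_n -> 'I_n -> 'I_n -> R) :
    \sum_a \sum_(b | E a b) \sum_(c | [&& cw3 a c b, E a c & E c b])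
       (F a b c - G a b c) =
    \sum_a \sum_b \sum_c (t a c b)%:R * F a b c -
    \sum_a \sum_b \sum_c (t a c b)%:R * G a b c.
  rewrite -sumrB; apply: eq_bigr => a _; rewrite -sumrB big_mkcond.
  apply: eq_bigr => b _; rewrite -sumrB /t; case: (E a b) => /=; last first.
    by rewrite big1 // => c _; rewrite andbF !mul0r subrr.
  rewrite big_mkcond; apply: eq_bigr => c _.
  by case: ifP; rewrite ?mul1r ?mul0r ?subrr.
under eq_bigr => a _ do under eq_bigr => b _ do
  (rewrite mulr_sumr; under eq_bigr => c _ do rewrite mulrBr).
rewrite unfold.
under [RHS]eq_bigr => a _ do under eq_bigr => b _ do
  (rewrite /Y mulr_sumr; under eq_bigr => c _ do rewrite mulrBr).
rewrite unfold; congr (_ - _).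
  rewrite sum_rot; apply: eq_bigr => a _; apply: eq_bigr => b _.
  by apply: eq_bigr => c _; rewrite (t_rot a c b) (WC c) (XC b) [W _ _ * _]mulrC.
rewrite [RHS]sum_rot; apply: eq_bigr => a _; apply: eq_bigr => b _.
by apply: eq_bigr => c _; rewrite (t_rot a c b) (WC b) (XC c) [W _ _ * _]mulrC.
Qed.

(** Up to terms attached to the leaves, the weight is minus a tree metric on the
    dual tree: after summation by parts the coefficient of an interior edge is
    the difference that the condition on quadrilaterals makes negative. *)
Lemma weight_tree : quadrilateral_weight_map wT ->
  exists (lam : 'I_n -> 'I_n -> R) (h : 'I_n -> R),
  (forall ij : pidx n, weight_vector wT ij *+ 4 =
     \sum_a \sum_(b | E a b) (chi a b (val ij).1 (val ij).2)%:R * lam a b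
       + h (val ij).1 + h (val ij).2) /\
  (forall a b c d, E a b -> cw3 a c b -> cw3 b d a -> lam a b < 0).
Proof.
move=> hw; exists (fun a b => Y a b + Y b a).
pose h i := \sum_a \sum_(b | E a b) W a b * (if b == ordS a then (i == b)%:R else 0).
exists (fun i => h i *+ 2); split; last first.
  move=> a b c0 d0 ab ac0b bd0a; have ba : E b a by rewrite Esym.
  have [c [acb ac cb]] := third_vertex triE ab ac0b.
  have [d [bda bd da]] := third_vertex triE ba bd0a.
  have H g k l : cw3 g k l -> E g k -> E k l -> Y g l = W g k - W k l.
    move=> gkl gk kl; rewrite /Y (big_pred1 k) // => k1 /=.
    apply/and3P/eqP=> [[h1 h2 h3]|-> //].
    exact: (third_vertex_uniq triE h1 gkl).
  rewrite (H _ c) // (H _ d) //.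
  have q : cw4 a c b d by move: acb bda; cyc a.
  have /(_ q ac cb bd) := hw a c b d.
  rewrite -/(arc_rel T a d) -/E Esym da -/(arc_rel T a b) -/E ab => /(_ isT isT).
  rewrite !linearD /= -/(W a d) -/(W c b) -/(W a c) -/(W b d) (WC a d) => lt.
  by rewrite addrACA -opprD subr_lt0 [X in _ < X]addrC.
move=> [[i j] /= ltij]; set w := weight_vector _ _.
have nij : i != j by rewrite -val_eqE /= ltn_eqF.
pose D a b : R := (corner T a b i j)%:~R.
have Sc : \sum_a \sum_(b | E a b) W a b * D b a = \sum_a \sum_(b | E a b) W a b * D a b.
  rewrite (exchange_big_dep predT) //=; apply: eq_bigr => a _.
  by apply: eq_big => b; [rewrite Esym|rewrite WC].
(* One factor 2 comes from the formula for the signs, the other one from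
   counting every arc with both orientations. *)
have e4 : w *+ 4 = (\sum_a \sum_(b | E a b) W a b * D a b) *+ 2.
  rewrite [RHS]mulr2n -{2}Sc -big_split /=.
  rewrite /w weight_vectorE /= -[4%N]/(2 * 2)%N mulrnA -sumrMnl -sum_arcs.
  apply: eq_bigr => a _; rewrite -big_split; apply: eq_bigr => b ab /=.
  rewrite -mulrDr /D -rmorphD -sigma_corner // mulrC -/(W a b).
  by rewrite rmorphMn mulrnAr.
pose X a b : R := (chi a b i j)%:R.
have XC a b : X a b = X b a by rewrite /X /chi; do 4 case: (_ <= _)%N.
have eD : \sum_a \sum_(b | E a b) W a b * D a b =
    \sum_a \sum_(b | E a b) X a b * Y a b + h i + h j.
  rewrite -sum_triangles // /h -!big_split /=; apply: eq_bigr => a _.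
  rewrite -!big_split /=; apply: eq_bigr => b _.
  rewrite /D /corner rmorphD rmorph_sum /= -addrA -!mulrDr; congr (_ * (_ + _)).
    apply: eq_bigr => c _; rewrite rmorphB /= /X.
    by case: (chi c b i j); case: (chi a c i j).
  case: ifP => _; last by rewrite addr0.
  by rewrite rmorphD /=; case: (_ == _); case: (_ == _).
rewrite e4 eD !mulrnDl; congr (_ + _ + _).
rewrite mulr2n.
have {2}-> : \sum_a \sum_(b | E a b) X a b * Y a b =
    \sum_a \sum_(b | E a b) X a b * Y b a.
  rewrite (exchange_big_dep predT) //=; apply: eq_bigr => a _.
  by apply: eq_big => b; [rewrite Esym|rewrite XC].
rewrite -big_split; apply: eq_bigr => a _ /=; rewrite -big_split /=.
by apply: eq_bigr => b _; rewrite -mulrDr.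
Qed.

End Weight.

(** * Quartets of leaves *)

(** The arc from [a] to [b] separates the leaves [i], [j] from [k], [l]. *)
Definition split_outer (n : nat) (i j k l a b : 'I_n) : bool :=
  (j <= a < k)%N && ((b < i) || (l <= b))%N ||
  (j <= b < k)%N && ((a < i) || (l <= a))%N.

(** The arc from [a] to [b] separates the leaves [j], [k] from [i], [l]. *)
Definition split_inner (n : nat) (i j k l a b : 'I_n) : bool :=
  (i <= a < j)%N && (k <= b < l)%N || (i <= b < j)%N && (k <= a < l)%N.

Section Quartet.
Variables (n : nat) (i j k l : 'I_n).
Hypothesis ijkl : [/\ (i < j)%N, (j < k)%N & (k < l)%N].

Lemma chi_outer a b :
  (chi a b i k + chi a b j l =
   chi a b i j + chi a b k l + (split_outer i j k l a b).*2)%N.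
Proof.
have [ij jk kl] := ijkl; rewrite /chi /split_outer.
have bits (v : 'I_n) : [|| [&& i <= v, j <= v, k <= v & l <= v],
   [&& i <= v, j <= v, k <= v & v < l], [&& i <= v, j <= v, v < k & v < l],
   [&& i <= v, v < j, v < k & v < l] | [&& v < i, v < j, v < k & v < l]]%N.
  by lia.
move: (bits a) (bits b); rewrite !ltnNge.
by do 8 case: (_ <= _)%N.
Qed.

Lemma chi_inner a b :
  (chi a b i k + chi a b j l =
   chi a b i l + chi a b j k + (split_inner i j k l a b).*2)%N.
Proof.
have [ij jk kl] := ijkl; rewrite /chi /split_inner.
have bits (v : 'I_n) : [|| [&& i <= v, j <= v, k <= v & l <= v],
   [&& i <= v, j <= v, k <= v & v < l], [&& i <= v, j <= v, v < k & v < l],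
   [&& i <= v, v < j, v < k & v < l] | [&& v < i, v < j, v < k & v < l]]%N.
  by lia.
move: (bits a) (bits b); rewrite !ltnNge.
by do 8 case: (_ <= _)%N.
Qed.

Variable E : rel 'I_n.
Hypothesis triE : tri_rel E.

(** Existence is the existence of an arc between opposite parts.  An arc that
    separates [i], [j] from [k], [l] and one that separates [j], [k] from
    [i], [l] would cross. *)
Lemma quartet_split :
  (exists a b, E a b /\ split_outer i j k l a b) /\
    (forall a b, E a b -> ~~ split_inner i j k l a b) \/
  (exists a b, E a b /\ split_inner i j k l a b) /\
    (forall a b, E a b -> ~~ split_outer i j k l a b).
Proof.
have [ij jk kl] := ijkl; have [_ _ Enc _] := triE.
have excl a b c d : E a c -> E b d -> split_outer i j k l a c ->
    split_inner i j k l b d -> false.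
  move=> ac bd h1 h2; move: (Enc _ _ _ _ ac bd); apply: contraNT => _.
  move: h1 h2; rewrite /split_outer /split_inner /crosses /cw4.
  by case/orP=> /andP[h1 /orP h1'] /orP[] /andP[h2 h3]; case: h1' => h4;
    move: ij jk kl h1 h4 h2 h3; clear; lia.
have q : cw4 i j k l by rewrite /cw4 ij jk kl.
have [a [c [ac [[h1 h2]|[h1 h2]]]]] := opposite_arc triE q; [right|left].
  have s : split_inner i j k l a c.
    by move: h1 h2; rewrite /seg /cw3 /split_inner -!val_eqE /=; lia.
  split; first by exists a, c.
  by move=> b d bd; apply/negP=> s'; have := excl _ _ _ _ bd ac s' s.
have s : split_outer i j k l a c.
  by move: h1 h2; rewrite /seg /cw3 /split_outer -!val_eqE /=; lia.
split; first by exists a, c.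
by move=> b d bd; apply/negP=> s'; have := excl _ _ _ _ ac bd s s'.
Qed.

Lemma split_outer_interior a b : split_outer i j k l a b ->
  (exists c, cw3 a c b) /\ (exists d, cw3 b d a).
Proof.
have [ij jk kl] := ijkl.
case/orP=> /andP[h1 /orP h2].
  by split; [exists k|exists i]; rewrite /cw3; case: h2 => ?; lia.
by split; [exists i|exists k]; rewrite /cw3; case: h2 => ?; lia.
Qed.

Lemma split_inner_interior a b : split_inner i j k l a b ->
  (exists c, cw3 a c b) /\ (exists d, cw3 b d a).
Proof.
have [ij jk kl] := ijkl.
case/orP=> /andP[h1 h2].
  by split; [exists j|exists l]; rewrite /cw3; lia.
by split; [exists l|exists j]; rewrite /cw3; lia.
Qed.

End Quartet.

(** * Monomials in the Plücker variables *)

Section Exponents.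
Variable n : nat.
Local Notation N := #|{: pidx n}|.
Implicit Types (m : 'X_{1..N}) (x : 'I_N) (i j : 'I_n).

Definition lo x : 'I_n := (val (enum_val x)).1.
Definition hi x : 'I_n := (val (enum_val x)).2.

Lemma lo_hi x : (lo x < hi x)%N.
Proof. exact: (valP (enum_val x)). Qed.

Definition pmon i j : 'X_{1..N} :=
  if insub (i, j) is Some ij then U_(enum_rank ij)%MM else 0%MM.

Lemma lo_hi_inj x y : lo x = lo y -> hi x = hi y -> x = y.
Proof.
rewrite /lo /hi => e1 e2; apply: enum_val_inj; apply: val_inj.
by move: e1 e2; case: (val _) => a b /= ->; case: (val _) => c d /= ->.
Qed.

Lemma pmonP i j : (i < j)%N ->
  exists x, [/\ pmon i j = U_(x)%MM, lo x = i & hi x = j].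
Proof.
move=> ij; rewrite /pmon insubT; set p := Sub _ _.
by exists (enum_rank p); rewrite /lo /hi enum_rankK.
Qed.

Lemma pmon_lo_hi x : pmon (lo x) (hi x) = U_(x)%MM.
Proof.
have [y [-> e1 e2]] := pmonP (lo_hi x).
by rewrite (lo_hi_inj e1 e2).
Qed.

Definition msum (v : 'I_n -> 'I_n -> nat) m : nat :=
  \sum_x m x * v (lo x) (hi x).

Lemma msumD v m m' : msum v (m + m')%MM = (msum v m + msum v m')%N.
Proof.
by rewrite /msum -big_split; apply: eq_bigr => x _; rewrite mnmDE mulnDl.
Qed.

Lemma msumU v x : msum v U_(x)%MM = v (lo x) (hi x).
Proof.
rewrite /msum (bigD1 x) //= mnmE eqxx mul1n big1 ?addn0 // => y yx.
by rewrite mnmE eq_sym (negPf yx) mul0n.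
Qed.

Lemma msum_pmon v i j : (i < j)%N -> msum v (pmon i j) = v i j.
Proof. by case/pmonP=> x [-> <- <-]; rewrite msumU. Qed.

Lemma eq_msum v v' m : (forall x, (0 < m x)%N -> v (lo x) (hi x) = v' (lo x) (hi x)) ->
  msum v m = msum v' m.
Proof.
move=> h; apply: eq_bigr => x _.
by case: (m x) (h x) => [|k] h'; rewrite ?mul0n // h'.
Qed.

Lemma leq_msum v v' m : (forall i j, (i < j)%N -> (v i j <= v' i j)%N) ->
  (msum v m <= msum v' m)%N.
Proof. by move=> h; apply: leq_sum => x _; rewrite leq_mul2l h ?orbT ?lo_hi. Qed.

Lemma msum_add v v' m :
  (msum v m + msum v' m)%N = msum (fun i j => v i j + v' i j)%N m.
Proof. by rewrite /msum -big_split; apply: eq_bigr => x _; rewrite mulnDr. Qed.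

Definition noncross m : bool :=
  [forall x, forall y, (0 < m x)%N && (0 < m y)%N ==>
     ~~ [&& (lo x < lo y)%N, (lo y < hi x)%N & (hi x < hi y)%N]].

Lemma noncrossP m x y : noncross m -> (0 < m x)%N -> (0 < m y)%N ->
  ~~ [&& (lo x < lo y)%N, (lo y < hi x)%N & (hi x < hi y)%N].
Proof.
move=> /forallP/(_ x)/forallP/(_ y)/implyP h hx hy; apply: h.
by rewrite hx hy.
Qed.

(** The leaf [p] lies in the cyclic interval from [a] (excluded) to [b]. *)
Let between (a b p : 'I_n) : bool :=
  ((p <= a)%N (+) (p <= b)%N) (+) (b < a)%N.

Let joins a b c d p q : bool :=
  between a b p && between c d q || between c d p && between a b q.

(** The four cuts divide the leaves into four cyclic parts.  Only arcs that join
    opposite parts are counted differently by the three sums, and non-crossing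
    arcs join opposite parts in one of the two possible ways only.  This is
    Ptolemy's relation in tropical form. *)
Lemma tropical_exchange m a b c d : noncross m -> cw4 a b c d ->
  (msum (chi a c) m + msum (chi b d) m)%N =
  maxn (msum (chi a b) m + msum (chi c d) m)
       (msum (chi a d) m + msum (chi b c) m).
Proof.
move=> ncm q.
have bits (v : 'I_n) : [||
   [&& between a b v, ~~ between b c v, ~~ between c d v & ~~ between d a v],
   [&& ~~ between a b v, between b c v, ~~ between c d v & ~~ between d a v],
   [&& ~~ between a b v, ~~ between b c v, between c d v & ~~ between d a v] |
   [&& ~~ between a b v, ~~ between b c v, ~~ between c d v & between d a v]].
  by move: q; rewrite /between /cw4; case/or4P=> /and3P[]; lia.
have chi_between e f p q' : chi e f p q' = between e f p (+) between e f q'.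
  by rewrite /chi /between; do 5 case: (_ <= _)%N.
have chi_add (e f g p q' : 'I_n) : chi e g p q' = chi e f p q' (+) chi f g p q'.
  by rewrite /chi; do 6 case: (_ <= _)%N.
have chiC (e f p q' : 'I_n) : chi e f p q' = chi f e p q'.
  by rewrite /chi; do 4 case: (_ <= _)%N.
have exch p q' :
    (chi a c p q' + chi b d p q' =
     chi a b p q' + chi c d p q' + (joins b c d a p q').*2)%N /\
    (chi a c p q' + chi b d p q' =
     chi a d p q' + chi b c p q' + (joins a b c d p q').*2)%N.
  rewrite (chi_add a b c) (chi_add b c d) (chiC a d) !chi_between /joins.
  move: (bits p) (bits q').
  by case: (between a b p); case: (between b c p); case: (between c d p);
     case: (between d a p); case: (between a b q'); case: (between b c q');
     case: (between c d q'); case: (between d a q').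
have [nbd|] := boolP [forall x, (0 < m x)%N ==> ~~ joins b c d a (lo x) (hi x)].
  have e : msum (fun p q' => chi a c p q' + chi b d p q')%N m =
           msum (fun p q' => chi a b p q' + chi c d p q')%N m.
    apply: eq_msum => x hx; rewrite (proj1 (exch _ _)).
    by move/forallP/(_ x): nbd; rewrite hx => /negPf->; rewrite addn0.
  rewrite !msum_add e; apply/esym/maxn_idPl; rewrite -e.
  by apply: leq_msum => p q' _; rewrite (proj2 (exch _ _)) leq_addr.
rewrite negb_forall => /existsP[y]; rewrite negb_imply negbK => /andP[hy jy].
have e : msum (fun p q' => chi a c p q' + chi b d p q')%N m =
         msum (fun p q' => chi a d p q' + chi b c p q')%N m.
  apply: eq_msum => x hx; rewrite (proj2 (exch _ _)).
  have /negPf-> : ~~ joins a b c d (lo x) (hi x); last by rewrite addn0.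
  apply/negP=> jx; have := noncrossP ncm hx hy; have := noncrossP ncm hy hx.
  move: jx jy (lo_hi x) (lo_hi y) q; rewrite /joins /between /cw4; clear.
  move: (lo x) (hi x) (lo y) (hi y) => p1 p2 r1 r2.
  by case/orP=> /andP[h1 h2] /orP[] /andP[h3 h4] h5 h6 /or4P[] /and3P[h7 h8 h9];
     move: h1 h2 h3 h4; rewrite !ltnNge; lia.
rewrite !msum_add e; apply/esym/maxn_idPr; rewrite -e.
by apply: leq_msum => p q' _; rewrite (proj1 (exch _ _)) leq_addr.
Qed.

(** An arc outside of the triangulation is crossed by some arc of it; the
    exchange relation then computes its crossing number from those of arcs
    that cross fewer arcs of the triangulation. *)
Lemma chi_arcs_determine (E : rel 'I_n) m m' : tri_rel E ->
  noncross m -> noncross m' ->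
  (forall a b, E a b -> msum (chi a b) m = msum (chi a b) m') ->
  forall a b, msum (chi a b) m = msum (chi a b) m'.
Proof.
move=> triE ncm ncm' eqE; have [_ Esym _ _] := triE.
have chiC a b : msum (chi a b) =1 msum (chi b a).
  by move=> m0; apply: eq_msum => x _; rewrite /chi; do 4 case: (_ <= _)%N.
suff H N a b : (ncross E a b < N)%N -> msum (chi a b) m = msum (chi a b) m'.
  by move=> a b; apply: (H (ncross E a b).+1).
elim: N a b => // N IH a b; rewrite ltnS => hN.
have [->|nab] := eqVneq a b.
  have z m0 : msum (chi b b) m0 = 0%N.
    by rewrite /msum big1 // => x _; rewrite /chi !addbb muln0.
  by rewrite !z.
have [ab|nE] := boolP (E a b); first exact: eqE.
have [c [d [cd q]]] := crossing_arc triE nab nE.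
have q' : cw4 c b d a by move: q; rewrite /cw4; lia.
have [h1 h2 h3 h4] := ncross_quad triE q' cd.
have e1 := tropical_exchange ncm q'; have e2 := tropical_exchange ncm' q'.
rewrite (ncrossC E b a) in h1 h2 h3 h4.
have {}h1 := leq_trans h1 hN; have {}h2 := leq_trans h2 hN.
have {}h3 := leq_trans h3 hN; have {}h4 := leq_trans h4 hN.
have f : msum (chi c d) m = msum (chi c d) m' by apply: eqE.
rewrite (IH _ _ h1) (IH _ _ h2) (IH _ _ h3) (IH _ _ h4) f -e2 in e1.
by rewrite (chiC a b) [RHS]chiC; apply: (addnI e1).
Qed.

(** The multiplicity of the arc [pq] is a mixed second difference of crossing
    numbers: only this arc changes sides when either end point is passed. *)
Lemma chi_determine m m' :
  (forall a b, msum (chi a b) m = msum (chi a b) m') -> m = m'.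
Proof.
move=> h; apply/mnmP=> x.
have := ltn_ord (lo x); have := ltn_ord (hi x); move: (lo_hi x).
set p := lo x; set q := hi x => lt_pq ltq ltp.
pose p' := ord_pred p; pose q' := ord_pred q.
have pt (r s : 'I_n) : (r < s)%N ->
    (chi p' q' r s + chi p q r s =
     chi p' q r s + chi p q' r s + ((r == p) && (s == q)).*2)%N.
  (* The predecessor of the first vertex is the last one, and gives the
     complementary interval; this changes both halves of [chi]. *)
  have flip (u u' v : 'I_n) : u' = ord_pred u ->
      ((v <= u') = (v <= u) (+) (v == u) (+) (u == 0 :> nat))%N.
    have := ltn_ord v; have := ltn_ord u.
    by move=> hu hv ->; rewrite val_ord_pred -[v == u]val_eqE /=; case: eqP; lia.
  move=> rs; rewrite /chi !(flip p p') // !(flip q q') //.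
  rewrite -![_ == _ :> 'I_n]val_eqE /=.
  have [h1 h2 h3] : [/\ ((r == p :> nat) && (s == q :> nat) ->
       [/\ (r <= p), (r <= q), ~~ (s <= p) & (s <= q)])%N,
     (r == p :> nat)%N && (r == q :> nat)%N = false &
     (s == p :> nat)%N && (s == q :> nat)%N = false].
    split; [case/andP=> /eqP-> /eqP->; split|..]; lia.
  have h4 : (r == q :> nat)%N && (s == p :> nat)%N = false by lia.
  move: h1 h2 h3 h4.
  case: (r == p :> nat)%N; case: (s == q :> nat)%N; case: (r == q :> nat)%N;
  case: (s == p :> nat)%N => //= h1 _ _ _; rewrite ?addbF ?addbT;
  try (by case: (h1 isT) => -> -> /negPf-> ->; case: eqP; case: eqP);
  by case: (r <= p)%N; case: (r <= q)%N; case: (s <= p)%N; case: (s <= q)%N;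
     case: eqP; case: eqP.
have key m0 : (msum (chi p' q') m0 + msum (chi p q) m0 =
    msum (chi p' q) m0 + msum (chi p q') m0 + (m0 x).*2)%N.
  rewrite !msum_add.
  have -> : (m0 x).*2 = msum (fun r s => ((r == p) && (s == q)).*2) m0.
    rewrite /msum (bigD1 x) //= !eqxx muln2 big1 ?addn0 // => y yx.
    case: andP => [[/eqP e1 /eqP e2]|_]; last by rewrite muln0.
    by rewrite (lo_hi_inj e1 e2) eqxx in yx.
  by rewrite msum_add; apply: eq_msum => y _; apply: pt; apply: lo_hi.
have := key m; have := key m'; rewrite !h => -> /addnI.
by move/double_inj.
Qed.

End Exponents.

(** * Ideals generated by a set *)

Section IdealGen.
Variables (P : comNzRingType) (G : set P).

Lemma ideal_gen_mem g : G g -> ideal_gen G g.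
Proof.
move=> Gg; exists [:: (1, g)]; last by rewrite big_seq1 mul1r.
by move=> u; rewrite inE => /eqP->.
Qed.

Lemma ideal_gen0 : ideal_gen G 0.
Proof. by exists [::]; rewrite ?big_nil. Qed.

Lemma ideal_genD f g : ideal_gen G f -> ideal_gen G g -> ideal_gen G (f + g).
Proof.
case=> s Gs -> [t Gt ->]; exists (s ++ t); last by rewrite big_cat.
by move=> u; rewrite mem_cat => /orP[/Gs|/Gt].
Qed.

Lemma ideal_genM a f : ideal_gen G f -> ideal_gen G (a * f).
Proof.
case=> s Gs ->; exists [seq (a * u.1, u.2) | u <- s].
  by move=> u /mapP[v /Gs Gv ->].
by rewrite big_map mulr_sumr; apply: eq_bigr => u _; rewrite mulrA.
Qed.

Lemma ideal_genN f : ideal_gen G f -> ideal_gen G (- f).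
Proof. by rewrite -mulN1r; apply: ideal_genM. Qed.

Lemma ideal_genB f g : ideal_gen G f -> ideal_gen G g -> ideal_gen G (f - g).
Proof. by move=> If /ideal_genN; apply: ideal_genD. Qed.

Lemma ideal_gen_sum (I : eqType) (r : seq I) (F : I -> P) :
  (forall i, i \in r -> ideal_gen G (F i)) -> ideal_gen G (\sum_(i <- r) F i).
Proof.
move=> h; rewrite big_seq; apply: (big_ind (ideal_gen G)) => //.
  exact: ideal_gen0.
by move=> f g; apply: ideal_genD.
Qed.

Lemma ideal_gen_min (J : P -> Prop) : J 0 -> (forall f g, J f -> J g -> J (f + g)) ->
  (forall a f, J f -> J (a * f)) -> (forall g, G g -> J g) ->
  forall f, ideal_gen G f -> J f.
Proof.
move=> J0 JD JM JG f [s Gs ->]; rewrite big_seq; apply: (big_ind J) => //.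
by move=> u /Gs/JG; apply: JM.
Qed.

End IdealGen.

Lemma ideal_gen_sub (P : comNzRingType) (G H : set P) :
  (forall g, G g -> ideal_gen H g) -> forall f, ideal_gen G f -> ideal_gen H f.
Proof.
move=> h; apply: ideal_gen_min => //; first exact: ideal_gen0.
- exact: ideal_genD.
- exact: ideal_genM.
Qed.

(** * Independence of the non-crossing monomials *)

Section Fan.
Variable n : nat.
Hypothesis n2 : (2 < n)%N.

(** The triangulation in which all diagonals meet at the last vertex. *)
Definition fan : rel 'I_n := fun a b =>
  (a != b) && [|| a.+1 == b, b.+1 == a, a == n.-1 :> nat | b == n.-1 :> nat].

Lemma fan_tri : tri_rel fan.
Proof.
split.
- by move=> a b /andP[].
- by move=> a b; rewrite /fan eq_sym; congr andb; lia.
- move=> a b c d; rewrite /fan /crosses /cw4 -!val_eqE /=.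
  have := ltn_ord a; have := ltn_ord b; have := ltn_ord c; have := ltn_ord d.
  move=> h1 h2 h3 h4 /andP[h5 /or4P h6] /andP[h7 /or4P h8].
  by case: h6 => h6; case: h8 => h8; lia.
move=> a c nac h; apply: contraT => nf.
have lt1 (x y : 'I_n) : (x < y)%N -> ~~ fan x y -> exists b d, fan b d /\ crosses x y b d.
  move=> xy; have hy := ltn_ord y; have lx : (x.+1 < n)%N by lia.
  have ln : (n.-1 < n)%N by lia.
  rewrite /fan -val_eqE /= => nxy.
  exists (Ordinal lx), (Ordinal ln); rewrite /crosses /cw4 /= eqxx.
  by rewrite -val_eqE /=; lia.
have [|] := ltnP a c => ac.
  by have [b [d [/h/negP bd]]] := lt1 a c ac nf.
have ca : (c < a)%N by move: nac; rewrite -val_eqE /=; lia.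
have [|b [d [/h/negP bd cr]]] := lt1 c a ca.
  by move: nf; rewrite /fan eq_sym; lia.
by exfalso; apply: bd; move: cr; rewrite /crosses /cw4; lia.
Qed.

Local Notation N := #|{: pidx n}|.

Definition vdeg (v p q : 'I_n) : nat := (p == v) + (q == v).
Definition vleft (v p q : 'I_n) : nat := (p == v).

Lemma msum_sum (P : pred 'I_n) (F : 'I_n -> 'I_n -> 'I_n -> nat) (m : 'X_{1..N}) :
  msum (fun p q => \sum_(v | P v) F v p q)%N m = (\sum_(v | P v) msum (F v) m)%N.
Proof.
rewrite /msum exchange_big; apply: eq_bigr => x _ /=.
by rewrite big_distrr.
Qed.

(** Non-crossing arcs form a balanced parenthesis word, so that they are
    determined by the multiset of their end points and of their left end
    points; the fan at the last vertex makes this an instance of the general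
    rigidity of crossing numbers. *)
Lemma degrees_determine (m m' : 'X_{1..N}) : noncross m -> noncross m' ->
  (forall v, msum (vdeg v) m = msum (vdeg v) m') ->
  (forall v, msum (vleft v) m = msum (vleft v) m') -> m = m'.
Proof.
move=> ncm ncm' hd hl; apply: chi_determine.
apply: (chi_arcs_determine fan_tri ncm ncm').
have pick (a p : 'I_n) : (\sum_(v : 'I_n | (v <= a)%N) (p == v) = (p <= a)%N)%N.
  case: leqP => pa; first rewrite (bigD1 p) //= eqxx big1 ?addn0 //.
    by move=> v /andP[_]; rewrite eq_sym => /negPf->.
  by rewrite big1 // => v va; case: eqP => // e; move: va; rewrite -e leqNgt pa.
have succ_case (a b : 'I_n) : a.+1 == b -> forall m0 : 'X_{1..N},
    msum (chi a b) m0 = msum (vdeg b) m0.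
  move=> /eqP ab m0; apply: eq_msum => x _; have := lo_hi x.
  have H (v : 'I_n) : (v <= b)%N = (v == b) || (v <= a)%N.
    by rewrite -[v == b]val_eqE /= -ab; lia.
  have H' (v : 'I_n) : v = b -> (v <= a)%N = false by move=> ->; rewrite -ab ltnn.
  rewrite /vdeg /chi !H.
  case: (lo x =P b) => [e1|_]; case: (hi x =P b) => [e2|_] /=.
  - by rewrite e1 e2 ltnn.
  - by rewrite (H' _ e1) addbb.
  - by rewrite (H' _ e2) addbb.
  by case: (lo x <= a)%N; case: (hi x <= a)%N.
have last_case (a b : 'I_n) : b == n.-1 :> nat -> forall m0 : 'X_{1..N},
    (msum (chi a b) m0 + \sum_(v : 'I_n | (v <= a)%N) msum (vdeg v) m0 =
     (\sum_(v : 'I_n | (v <= a)%N) msum (vleft v) m0).*2)%N.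
  move=> /eqP ab m0; rewrite -!msum_sum -addnn !msum_add.
  apply: eq_msum => x _; have := lo_hi x.
  rewrite /vleft /vdeg big_split /= !pick /chi ab.
  have := ltn_ord (lo x); have := ltn_ord (hi x).
  by case: (leqP (lo x) a); case: (leqP (hi x) a);
     case: (leqP (lo x) n.-1); case: (leqP (hi x) n.-1); lia.
have chiC a b (m0 : 'X_{1..N}) : msum (chi a b) m0 = msum (chi b a) m0.
  by apply: eq_msum => x _; rewrite /chi; do 4 case: (_ <= _)%N.
have last_eq (a b : 'I_n) : b == n.-1 :> nat -> msum (chi a b) m = msum (chi a b) m'.
  move=> hb; have e := last_case a b hb m; have e' := last_case a b hb m'.
  move: e; rewrite (eq_bigr _ (fun v _ => hl v)) -e' (eq_bigr _ (fun v _ => hd v)).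
  exact: addIn.
move=> a b /andP[_ /or4P[]] h.
- by rewrite !(succ_case _ _ h) hd.
- by rewrite chiC [RHS]chiC !(succ_case _ _ h) hd.
- by rewrite chiC [RHS]chiC; apply: last_eq.
- exact: last_eq.
Qed.

End Fan.

Section Independence.
Variables (R : realType) (n : nat).
Hypothesis n2 : (2 < n)%N.
Local Notation N := #|{: pidx n}|.
Local Notation K := R[i].
Local Notation Q := {mpoly K[n + n]}.

Let s_ (i : 'I_n) : Q := 'X_(lshift n i).
Let x_ (i : 'I_n) : Q := 'X_(rshift n i).

(** The Plücker coordinates of the matrix with columns [s_i (1, - x_i)]. *)
Definition minor (i j : 'I_n) : Q := s_ i * s_ j * (x_ i - x_ j).

Definition minors : plucker_ring R n -> Q :=
  mmap (@mpolyC (n + n) K) (fun y => minor (lo y) (hi y)).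

HB.instance Definition _ := GRing.RMorphism.on minors.

Lemma mleadU_lt (i j : 'I_n) : (i < j)%N ->
  (mlead (- x_ j : Q) < mlead (x_ i : Q))%O.
Proof.
move=> ij; rewrite mleadN !mleadXm; apply/ltmcP; first by rewrite !mdeg1.
exists (rshift n i); last by rewrite !mnm1E eqxx eq_rshift -val_eqE /= gtn_eqF.
move=> k hk; rewrite !mnm1E; case: eqP => [e|_]; last case: eqP => // e.
  by move: hk; rewrite -e /=; lia.
by move: hk; rewrite -e ltnn.
Qed.

Lemma mlead_minor y : mlead (minor (lo y) (hi y)) =
  (U_(lshift n (lo y)) + U_(lshift n (hi y)) + U_(rshift n (lo y)))%MM.
Proof.
have lt := mleadU_lt (lo_hi y).
have nx (k : 'I_(n + n)) : 'X_k != 0 :> Q by rewrite -msupp_eq0 msuppX.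
have e : mlead (x_ (lo y) - x_ (hi y)) = U_(rshift n (lo y))%MM.
  by rewrite mleadDl // mleadXm.
have nz : x_ (lo y) - x_ (hi y) != 0.
  apply: contraTneq lt => /subr0_eq ->; rewrite mleadN ltxx //.
rewrite /minor mleadM ?e ?mulf_neq0 /s_ ?nx //.
by rewrite mleadM ?nx // !mleadXm.
Qed.

Lemma minor_neq0 y : minor (lo y) (hi y) != 0.
Proof.
have nx (k : 'I_(n + n)) : 'X_k != 0 :> Q by rewrite -msupp_eq0 msuppX.
rewrite !mulf_neq0 /s_ ?nx //; apply: contraTneq (mleadU_lt (lo_hi y)) => /subr0_eq ->.
by rewrite mleadN ltxx.
Qed.

Lemma minors_coord i j : minors (plucker_coord R i j) = minor i j.
Proof.
have h (p : pidx n) : minors (pvar R p) = minor (val p).1 (val p).2.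
  by rewrite /minors /pvar mmapX mmap1U /lo /hi enum_rankK.
rewrite /plucker_coord; case: insubP => [p _ e|].
  by rewrite h e.
rewrite -leqNgt /= => ji; case: insubP => [p _ e|].
  by rewrite rmorphN /= h e /= /minor [s_ i * _]mulrC -mulrN opprB.
rewrite -leqNgt /= => ij; have -> : i = j by apply: val_inj => /=; lia.
by rewrite raddf0 /minor subrr mulr0.
Qed.

Lemma minors_ideal f : plucker_ideal R n f -> minors f = 0.
Proof.
apply: (ideal_gen_min (J := fun g => minors g = 0)) => [||a g h|g].
- by rewrite raddf0.
- by move=> g h g0 h0; rewrite rmorphD /= g0 h0 addr0.
- by rewrite rmorphM /= h mulr0.
case=> i [j [k [l [_ ->]]]].
rewrite /plucker_rel rmorphD rmorphB !rmorphM /= !minors_coord /minor; ring.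
Qed.

Lemma mlead_minors m (F := fun y => minor (lo y) (hi y)) :
  mmap1 F m != 0 /\ forall k, mlead (mmap1 F m) k =
    match split k with inl v => msum (vdeg v) m | inr v => msum (vleft v) m end.
Proof.
have nz : mmap1 F m != 0.
  by apply/prodf_neq0 => y _; rewrite expf_neq0 // minor_neq0.
split=> // k; rewrite /mmap1 mlead_prod; last first.
  by move=> y _ _; rewrite expf_neq0 // minor_neq0.
rewrite mnm_sumE.
have e y : mlead (F y ^+ m y) k = (m y *
   ((lshift n (lo y) == k) + (lshift n (hi y) == k) + (rshift n (lo y) == k)))%N.
  by rewrite mleadX ?minor_neq0 // mulmnE mlead_minor !mnmDE !mnm1E mulnC.
rewrite (eq_bigr _ (fun y _ => e y)).
case: splitP => v ek; apply: eq_bigr => y _; congr (_ * _)%N.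
  have -> : k = lshift n v by apply: val_inj.
  by rewrite !eq_lshift eq_rlshift addn0.
have -> : k = rshift n v by apply: val_inj.
by rewrite !eq_lrshift eq_rshift.
Qed.

(** Distinct non-crossing monomials have distinct leading monomials under
    [minors], which record their end points and their left end points. *)
Lemma noncross_independent f : plucker_ideal R n f ->
  (forall m, m \in msupp f -> noncross m) -> f = 0.
Proof.
move=> /minors_ideal f0 ncf; apply/eqP; apply: contraT; rewrite -msupp_eq0 => nf.
pose F := fun y => minor (lo y) (hi y); pose B m := mlead (mmap1 F m).
have [m0 m0f m0max] : exists2 m0, m0 \in msupp f &
    forall m, m \in msupp f -> (B m <= B m0)%O.
  elim: (msupp f) nf => // m s IH _.
  have [->|/IH[m0 m0s h]] := eqVneq s [::].
    by exists m; rewrite ?inE // => m'; rewrite inE => /eqP->.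
  have [le|/ltW le] := leP (B m) (B m0).
    exists m0; first by rewrite inE m0s orbT.
    by move=> m'; rewrite inE => /predU1P[->|/h].
  exists m; first by rewrite inE eqxx.
  by move=> m'; rewrite inE => /predU1P[->|/h/le_trans]; last apply.
have : (minors f)@_(B m0) = 0 by rewrite f0 mcoeff0.
rewrite /minors /mmap raddf_sum /= (bigD1_seq m0 m0f (msupp_uniq f)) /=.
rewrite mul_mpolyC mcoeffZ big1_seq ?addr0 => [/eqP|m /andP[nm mf]]; last first.
  rewrite mul_mpolyC mcoeffZ [X in _ * X]mcoeff_gt_mlead ?mulr0 //.
  rewrite lt_neqAle m0max // andbT; apply: contra_neq nm => eB.
  have eBk k : B m k = B m0 k := congr1 (fun b : 'X_{1..n + n} => b k) eB.
  apply: degrees_determine; rewrite ?ncf // => v.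
    have := eBk (lshift n v); rewrite /B !(proj2 (mlead_minors _)).
    by rewrite (unsplitK (inl v)).
  have := eBk (rshift n v); rewrite /B !(proj2 (mlead_minors _)).
  by rewrite (unsplitK (inr v)).
rewrite mulf_eq0 mleadc_eq0 (negPf (proj1 (mlead_minors m0))) orbF.
by rewrite mcoeff_eq0 m0f.
Qed.


End Independence.

(** * Initial forms of Plücker relations *)

Section InitialForm.
Variables (R : realType) (n : nat) (w : pidx n -> R).
Local Notation N := #|{: pidx n}|.
Local Notation S := (plucker_ring R n).
Local Notation wt := (mnm_weight w).

Lemma mnm_weightD (m m' : 'X_{1..N}) : wt (m + m')%MM = wt m + wt m'.
Proof.
rewrite /mnm_weight -big_split; apply: eq_bigr => x _.
by rewrite mnmDE mulrnDr.
Qed.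

Lemma mnm_weightU (x : 'I_N) : wt U_(x)%MM = w (enum_val x).
Proof.
rewrite /mnm_weight (bigD1 x) //= mnm1E eqxx big1 ?addr0 // => y yx.
by rewrite mnm1E eq_sym (negPf yx).
Qed.

Lemma mcoeff_initial (f : S) m : (initial_form w f)@_m =
  if (m \in msupp f) && all (fun m' => wt m <= wt m') (msupp f) then f@_m else 0.
Proof.
rewrite /initial_form raddf_sum /=; case: ifP => [/andP[mf hm]|h].
  rewrite -big_filter (bigD1_seq m) ?mem_filter ?mf ?hm ?filter_uniq ?msupp_uniq //=.
  rewrite mcoeffZ mcoeffX eqxx mulr1 big1 ?addr0 // => m' m'm.
  by rewrite mcoeffZ mcoeffX (negPf m'm) mulr0.
rewrite big_seq_cond big1 // => m' /andP[m'f hm'].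
rewrite mcoeffZ mcoeffX; case: eqP => [e|_]; last by rewrite mulr0.
by move: h; rewrite -e m'f hm'.
Qed.

Lemma initial_trinomial (mg mx mo : 'X_{1..N}) : mg != mx ->
  wt mg = wt mx -> wt mg < wt mo ->
  initial_form w ('X_[mg] - 'X_[mx] + 'X_[mo] : S) = 'X_[mg] - 'X_[mx].
Proof.
move=> ngx egx lto; set f : S := (X in initial_form _ X).
have nog : (mo == mg) = false by apply: contraTF lto => /eqP->; rewrite ltxx.
have nox : (mo == mx) = false by apply: contraTF lto => /eqP->; rewrite egx ltxx.
have cf m : f@_m = (mg == m)%:R - (mx == m)%:R + (mo == m)%:R.
  by rewrite mcoeffD mcoeffB !mcoeffX.
have gf : mg \in msupp f.
  by rewrite mcoeff_msupp cf eqxx [mx == mg]eq_sym (negPf ngx) nog subr0 addr0 oner_eq0.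
have min m : wt m = wt mg -> all (fun m' => wt m <= wt m') (msupp f).
  move=> e; apply/allP => m'; rewrite mcoeff_msupp cf e.
  case: (mg =P m') => [<- //|_]; case: (mx =P m') => [<-|_]; first by rewrite egx.
  by case: (mo =P m') => [<- _|_]; rewrite ?subr0 ?addr0 ?eqxx // ltW.
apply/mpolyP => m; rewrite mcoeff_initial mcoeffB !mcoeffX.
have [<-|nm] := eqVneq mo m.
  rewrite [mg == mo]eq_sym [mx == mo]eq_sym nog nox subr0.
  case: ifP => // /andP[_ /allP/(_ _ gf)].
  by rewrite leNgt lto.
rewrite mcoeff_msupp cf (negPf nm) addr0.
have [e|ng] := eqVneq mg m.
  by rewrite min ?andbT -?e //; case: ifP => // /negbFE/eqP.
have [e|nx] := eqVneq mx m.
  by rewrite min ?andbT -?e -?egx //; case: ifP => // /negbFE/eqP.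
by rewrite subr0; case: ifP.
Qed.

Lemma plucker_coordX (i j : 'I_n) : (i < j)%N -> plucker_coord R i j = 'X_[pmon i j].
Proof. by move=> ij; rewrite /plucker_coord /pmon insubT. Qed.

End InitialForm.

Lemma binomial_supp (K : nzRingType) (N : nat) (m m' : 'X_{1..N}) : m != m' ->
  is_binomial ('X_[m] - 'X_[m'] : {mpoly K[N]}).
Proof.
move=> nm; rewrite /is_binomial -[RHS]/(size [:: m; m']).
apply/perm_size/uniq_perm; rewrite ?msupp_uniq //= ?inE ?andbT // => k.
rewrite mcoeff_msupp mcoeffB !mcoeffX !inE ![k == _]eq_sym.
have [e|_] := eqVneq m k; have [e'|_] := eqVneq m' k.
- by move: nm; rewrite e e' eqxx.
- by rewrite subr0 oner_eq0.
- by rewrite sub0r oppr_eq0 oner_eq0.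
by rewrite subrr eqxx.
Qed.

Lemma ideal_gen_coeff (K : comNzRingType) (N : nat) (G : set {mpoly K[N]}) f m :
  ideal_gen G f -> f@_m != 0 ->
  exists b al be, [/\ G b, be \in msupp b & (al + be)%MM = m].
Proof.
case=> s Gs ->; rewrite raddf_sum /= => nz.
have [[a b] ab nab] : exists2 u, u \in s & (u.1 * u.2)@_m != 0.
  apply/hasP; apply: contraNT nz => /hasPn h; rewrite big_seq big1 // => u /h.
  by rewrite negbK => /eqP.
have /msuppM_le/allpairsP[[al be] /= [_ hb e]] : m \in msupp (a * b).
  by rewrite mcoeff_msupp.
by exists b, al, be; split=> //; apply: (Gs _ ab).
Qed.

Section MonomialsOfQuartets.
Variable n : nat.
Local Notation N := #|{: pidx n}|.

Definition mcross (i j k l : 'I_n) : 'X_{1..N} := (pmon i k + pmon j l)%MM.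
Definition mouter (i j k l : 'I_n) : 'X_{1..N} := (pmon i j + pmon k l)%MM.
Definition minner (i j k l : 'I_n) : 'X_{1..N} := (pmon i l + pmon j k)%MM.

Definition sorted4 (i j k l : 'I_n) : bool := [&& i < j, j < k & k < l]%N.

Implicit Types i j k l : 'I_n.

Lemma sorted4_lt i j k l : sorted4 i j k l ->
  [/\ (i < j)%N, (j < k)%N, (k < l)%N & [/\ (i < k)%N, (j < l)%N & (i < l)%N]].
Proof. by case/and3P=> ij jk kl; do 2 split=> //; lia. Qed.

Lemma noncross_small (m : 'X_{1..N}) : (mdeg m < 2)%N -> noncross m.
Proof.
move=> m2; apply/forallP => x; apply/forallP => y; apply/implyP => /andP[mx my].
apply/negP=> /and3P[h _ _]; have nxy : y != x by apply: contraTneq h => ->; rewrite ltnn.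
by move: m2; rewrite mdegE (bigD1 x) // (bigD1 y) //=; lia.
Qed.

Lemma noncross_pair i j k l : (i < j)%N -> (k < l)%N ->
  ~~ crosses i j k l -> noncross (pmon i j + pmon k l)%MM.
Proof.
move=> ij kl ncr; have [x [-> ex ey]] := pmonP ij; have [y [-> fx fy]] := pmonP kl.
apply/forallP => p; apply/forallP => q; apply/implyP; rewrite !mnmDE !mnm1E.
move: ncr; rewrite /crosses /cw4 -ex -ey -fx -fy => ncr /andP[].
case: (x =P p) => [<- _|_]; last case: (y =P p) => [<- _|_ //].
  by case: (x =P q) => [<- _|_]; last case: (y =P q) => [<- _|_ //]; move: ncr; lia.
by case: (x =P q) => [<- _|_]; last case: (y =P q) => [<- _|_ //]; move: ncr; lia.
Qed.

Lemma noncross_outer i j k l : sorted4 i j k l -> noncross (mouter i j k l).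
Proof.
case/sorted4_lt=> ij jk kl _; apply: noncross_pair => //.
by rewrite /crosses /cw4; lia.
Qed.

Lemma noncross_inner i j k l : sorted4 i j k l -> noncross (minner i j k l).
Proof.
case/sorted4_lt=> ij jk kl [_ _ il]; apply: noncross_pair => //.
by rewrite /crosses /cw4; lia.
Qed.

Lemma cross_not_noncross i j k l : sorted4 i j k l -> ~~ noncross (mcross i j k l).
Proof.
case/sorted4_lt=> ij jk kl [ik jl _]; apply/negP => nc.
have [x [ex e1 e2]] := pmonP ik; have [y [ey f1 f2]] := pmonP jl.
have := noncrossP (x := x) (y := y) nc; rewrite /mcross ex ey !mnmDE !mnm1E !eqxx.
rewrite e1 e2 f1 f2 ij jk kl addn1 => h.
by have := h isT isT.
Qed.

(** The number of pairs of vertices whose arc separates the leaves [p] and [q].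
    Uncrossing a pair of arcs, in either way, decreases the total length. *)
Definition arc_length (p q : 'I_n) : nat := (q - p) * (n - (q - p)).

Lemma arc_length_uncross i j k l : sorted4 i j k l ->
  (msum arc_length (mouter i j k l) < msum arc_length (mcross i j k l))%N /\
  (msum arc_length (minner i j k l) < msum arc_length (mcross i j k l))%N.
Proof.
case/sorted4_lt=> ij jk kl [ik jl il].
rewrite !msumD !msum_pmon // /arc_length; have := ltn_ord l.
move: (nat_of_ord i) (nat_of_ord j) (nat_of_ord k) (nat_of_ord l) ij jk kl ik jl il.
move=> a b c d ab bc cd _ _ _ dn.
(* In terms of the four positive gaps, the two differences are twice the
   products of opposite gaps. *)
have [x [y [z [t [-> [-> [-> [-> h]]]]]]]] : exists x y z t,
   (b = a + x.+1 /\ c = a + x.+1 + y.+1 /\ d = a + x.+1 + y.+1 + z.+1 /\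
    n = x.+1 + y.+1 + z.+1 + t.+1 /\ true)%N.
  by exists (b - a).-1, (c - b).-1, (d - c).-1, (n - (d - a)).-1; repeat split; lia.
by split; nia.
Qed.

(** The sorted end points determine which of them are joined by crossing
    arcs. *)
Lemma cross_endpoints i j k l i' j' k' l' : sorted4 i j k l -> sorted4 i' j' k' l' ->
  (forall v, msum (vdeg v) (mcross i j k l) = msum (vdeg v) (mcross i' j' k' l')) ->
  [/\ i = i', j = j', k = k' & l = l'].
Proof.
move=> s s'; have [ij jk kl [ik jl il]] := sorted4_lt s.
have [ij' jk' kl' [ik' jl' il']] := sorted4_lt s' => h.
have {}h (v : 'I_n) : ((i == v :> nat) + (k == v :> nat) + ((j == v :> nat) + (l == v :> nat)) =
  (i' == v :> nat) + (k' == v :> nat) + ((j' == v :> nat) + (l' == v :> nat)))%N.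
  by have := h v; rewrite !msumD !msum_pmon // /vdeg -!val_eqE.
suff [? ? ? ?] : [/\ i = i' :> nat, j = j' :> nat, k = k' :> nat & l = l' :> nat].
  by split; apply: val_inj.
have mem (v : 'I_n) : v \in [:: i; j; k; l] = (v \in [:: i'; j'; k'; l']).
  have := h v; rewrite !inE ![v == _]eq_sym -!val_eqE /=.
  by do 8 case: (_ =P _ :> nat).
have hi : (i' <= i)%N by have := mem i; rewrite !inE eqxx -!val_eqE /=; lia.
have hi' : (i <= i')%N by have := mem i'; rewrite !inE eqxx -!val_eqE /=; lia.
have hl : (l <= l')%N by have := mem l; rewrite !inE eqxx !orbT -!val_eqE /=; lia.
have hl' : (l' <= l)%N by have := mem l'; rewrite !inE eqxx !orbT -!val_eqE /=; lia.
have hj : (j' <= j)%N by have := mem j; rewrite !inE eqxx !orbT -!val_eqE /=; lia.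
have hj' : (j <= j')%N by have := mem j'; rewrite !inE eqxx !orbT -!val_eqE /=; lia.
have hk : (k <= k')%N by have := mem k; rewrite !inE eqxx !orbT -!val_eqE /=; lia.
have hk' : (k' <= k)%N by have := mem k'; rewrite !inE eqxx !orbT -!val_eqE /=; lia.
by split; lia.
Qed.

End MonomialsOfQuartets.

(** * Reduction to non-crossing monomials *)

Section Main.
Variables (R : realType) (n : nat) (T : {set {set 'I_n}}).
Hypotheses (n2 : (2 < n)%N) (triT : triangulation T).
Variable wT : {linear arc_space R T -> R^o}.
Hypothesis wTP : quadrilateral_weight_map wT.

Local Notation N := #|{: pidx n}|.
Local Notation S := (plucker_ring R n).
Local Notation I := (plucker_ideal R n).
Implicit Types (m : 'X_{1..N}) (f g : S) (i j k l : 'I_n).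

Let w := weight_vector wT.
Let wt := mnm_weight w.
Let E := arc_rel T.
Let triE : tri_rel E := arc_rel_tri triT.

Definition same_crossings m m' : Prop :=
  forall a b, E a b -> msum (chi a b) m = msum (chi a b) m'.

Lemma same_crossingsD m m' r : same_crossings m m' ->
  same_crossings (m + r)%MM (m' + r)%MM.
Proof. by move=> h a b ab; rewrite !msumD h. Qed.

Lemma noncross_rigid m m' : noncross m -> noncross m' -> same_crossings m m' ->
  m = m'.
Proof.
by move=> nc nc' h; apply: chi_determine; apply: (chi_arcs_determine triE).
Qed.

Lemma weight_pmon : exists (lam : 'I_n -> 'I_n -> R) (h : 'I_n -> R),
  (forall i j, (i < j)%N -> wt (pmon i j) *+ 4 =
     \sum_a \sum_(b | E a b) (chi a b i j)%:R * lam a b + h i + h j) /\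
  (forall a b c d, E a b -> cw3 a c b -> cw3 b d a -> lam a b < 0).
Proof.
have [lam [h [e neg]]] := weight_tree n2 triT wTP; exists lam, h; split=> // i j ij.
have [x [-> <- <-]] := pmonP ij.
by rewrite /wt mnm_weightU e.
Qed.

Lemma quartet_weights i j k l : sorted4 i j k l ->
  exists lam : 'I_n -> 'I_n -> R,
  [/\ wt (mcross i j k l) *+ 4 = wt (mouter i j k l) *+ 4 +
        \sum_a \sum_(b | E a b) (split_outer i j k l a b).*2%:R * lam a b,
      wt (mcross i j k l) *+ 4 = wt (minner i j k l) *+ 4 +
        \sum_a \sum_(b | E a b) (split_inner i j k l a b).*2%:R * lam a b &
      forall a b c d, E a b -> cw3 a c b -> cw3 b d a -> lam a b < 0].
Proof.
move=> s; have [ij jk kl [ik jl il]] := sorted4_lt s.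
have [lam [h [e neg]]] := weight_pmon; exists lam.
pose Sg p q : R := \sum_a \sum_(b | E a b) (chi a b p q)%:R * lam a b.
split=> //.
  have eS : Sg i k + Sg j l = Sg i j + Sg k l +
      \sum_a \sum_(b | E a b) (split_outer i j k l a b).*2%:R * lam a b.
    rewrite /Sg -!big_split; apply: eq_bigr => a _; rewrite -!big_split /=.
    apply: eq_bigr => b _; rewrite -!mulrDl -!natrD /=.
    by rewrite (chi_outer (And3 ij jk kl)).
  rewrite /wt !mnm_weightD -/wt !mulrnDl !e // -!/(Sg _ _).
  by move: eS; move: (Sg _ _) (Sg _ _) (Sg _ _) (Sg _ _) (\sum_a _) => *; lra.
have eS : Sg i k + Sg j l = Sg i l + Sg j k +
    \sum_a \sum_(b | E a b) (split_inner i j k l a b).*2%:R * lam a b.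
  rewrite /Sg -!big_split; apply: eq_bigr => a _; rewrite -!big_split /=.
  apply: eq_bigr => b _; rewrite -!mulrDl -!natrD /=.
  by rewrite (chi_inner (And3 ij jk kl)).
rewrite /wt !mnm_weightD -/wt !mulrnDl !e // -!/(Sg _ _).
by move: eS; move: (Sg _ _) (Sg _ _) (Sg _ _) (Sg _ _) (\sum_a _) => *; lra.
Qed.

Lemma sum_split_lt0 (P : 'I_n -> 'I_n -> bool) (lam : 'I_n -> 'I_n -> R) :
  (forall a b, P a b -> (exists c, cw3 a c b) /\ (exists d, cw3 b d a)) ->
  (forall a b c d, E a b -> cw3 a c b -> cw3 b d a -> lam a b < 0) ->
  (exists a b, E a b /\ P a b) ->
  \sum_a \sum_(b | E a b) (P a b).*2%:R * lam a b < 0.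
Proof.
move=> int neg [a0 [b0 [ab0 p0]]].
have le0 a b : E a b -> (P a b).*2%:R * lam a b <= 0.
  move=> ab; case p: (P a b); last by rewrite mul0r.
  have [[c hc] [d hd]] := int _ _ p.
  by rewrite pmulr_rle0 ?ltr0n // ltW // (neg a b c d).
rewrite (bigD1 a0) //= (bigD1 b0) //=.
rewrite -addrA ltr_nwDl //.
  have [[c hc] [d hd]] := int _ _ p0.
  by rewrite p0 pmulr_rlt0 ?ltr0n // (neg a0 b0 c d).
rewrite -[leRHS]addr0 lerD //; first by apply: sumr_le0 => b /andP[ab _]; apply: le0.
by apply: sumr_le0 => a _; apply: sumr_le0 => b; apply: le0.
Qed.

Lemma sum_split_eq0 (P : 'I_n -> 'I_n -> bool) (lam : 'I_n -> 'I_n -> R) :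
  (forall a b, E a b -> ~~ P a b) ->
  \sum_a \sum_(b | E a b) (P a b).*2%:R * lam a b = 0.
Proof.
by move=> h; rewrite big1 // => a _; rewrite big1 // => b /h/negPf->; rewrite mul0r.
Qed.

(** An arc that separates [i], [j] from [k], [l] adds to the crossing numbers of
    the crossing pair and of the inner pair, but not to those of the outer one.
    As interior arcs have negative coefficients in the weight, the outer pair is
    the heavier one if such arcs exist; the other kind of arc is then absent.
    The second case is symmetric. *)
Lemma quartet_cases i j k l : sorted4 i j k l ->
  exists mg mo, [/\ (mg, mo) = (mouter i j k l, minner i j k l) \/
                    (mg, mo) = (minner i j k l, mouter i j k l),
    wt mg = wt (mcross i j k l), wt (mcross i j k l) < wt mo &
    same_crossings mg (mcross i j k l)].
Proof.
move=> s; have [ij jk kl [ik jl il]] := sorted4_lt s.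
have ijkl : [/\ (i < j)%N, (j < k)%N & (k < l)%N] by [].
have [lam [eo ei neg]] := quartet_weights s.
case: (quartet_split ijkl triE) => -[ex no].
  exists (minner i j k l), (mouter i j k l); split.
  - by right.
  - move: ei; rewrite (sum_split_eq0 _ no) addr0 => e.
    by apply/eqP; rewrite -(eqr_pMn2r (n := 4)) // e.
  - have lt0 := sum_split_lt0 (@split_outer_interior _ _ _ _ _ ijkl) neg ex.
    by rewrite -(ltr_pMn2r (n := 4)) // eo gtrDl.
  move=> a b ab; rewrite !msumD !msum_pmon // (chi_inner ijkl).
  by rewrite (negPf (no _ _ ab)) addn0.
exists (mouter i j k l), (minner i j k l); split.
- by left.
- move: eo; rewrite (sum_split_eq0 _ no) addr0 => e.
  by apply/eqP; rewrite -(eqr_pMn2r (n := 4)) // e.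
- have lt0 := sum_split_lt0 (@split_inner_interior _ _ _ _ _ ijkl) neg ex.
  by rewrite -(ltr_pMn2r (n := 4)) // ei gtrDl.
move=> a b ab; rewrite !msumD !msum_pmon // (chi_outer ijkl).
by rewrite (negPf (no _ _ ab)) addn0.
Qed.

Lemma plucker_relE i j k l : sorted4 i j k l ->
  plucker_rel R i j k l =
    'X_[mouter i j k l] - 'X_[mcross i j k l] + 'X_[minner i j k l].
Proof.
move=> s; have [ij jk kl [ik jl il]] := sorted4_lt s.
by rewrite /plucker_rel !plucker_coordX // -!mpolyXD.
Qed.

Lemma quartet_relation i j k l : sorted4 i j k l ->
  exists mg mo,
  [/\ [/\ wt mg = wt (mcross i j k l), wt (mcross i j k l) < wt mo,
        same_crossings mg (mcross i j k l) & noncross mg],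
      (msum (@arc_length n) mg < msum (@arc_length n) (mcross i j k l))%N,
      (msum (@arc_length n) mo < msum (@arc_length n) (mcross i j k l))%N,
      I ('X_[mcross i j k l] - 'X_[mg] - 'X_[mo]) &
      initial_form w (plucker_rel R i j k l) = 'X_[mg] - 'X_[mcross i j k l]].
Proof.
move=> s; have [mg [mo [e eg lo cr]]] := quartet_cases s.
have [len1 len2] := arc_length_uncross s.
have eR : plucker_rel R i j k l = 'X_[mg] - 'X_[mcross i j k l] + 'X_[mo].
  by rewrite plucker_relE //; case: e => -[-> ->] //; ring.
have ncg : noncross mg.
  by case: e => -[-> _]; [apply: noncross_outer|apply: noncross_inner].
exists mg, mo; split=> //.
- by case: e => -[-> _].
- by case: e => -[_ ->].
- have -> : 'X_[mcross i j k l] - 'X_[mg] - 'X_[mo] = - plucker_rel R i j k l.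
    by rewrite eR; ring.
  apply: ideal_genN; apply: ideal_gen_mem; exists i, j, k, l; split=> //.
  by have [ij jk kl _] := sorted4_lt s; rewrite /cw4 ij jk kl.
rewrite eR initial_trinomial //; last by rewrite -/wt eg.
by apply: contraTneq ncg => ->; apply: cross_not_noncross.
Qed.

Definition quartet_forms : set S := [set f | exists i j k l,
  sorted4 i j k l /\ f = initial_form w (plucker_rel R i j k l)]%classic.

Local Notation K := (ideal_gen quartet_forms).

Lemma crossing_factor m : ~~ noncross m -> exists i j k l r,
  sorted4 i j k l /\ m = (mcross i j k l + r)%MM.
Proof.
rewrite negb_forall => /existsP[x]; rewrite negb_forall => /existsP[y].
rewrite negb_imply negbK => /andP[/andP[mx my] s].
exists (lo x), (lo y), (hi x), (hi y), (m - (U_(x) + U_(y)))%MM; split=> //.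
rewrite /mcross !pmon_lo_hi addmC submK //; apply/mnm_lepP => z.
have nxy : (x == y) = false.
  by apply: contraTF s => /eqP->; rewrite ltnn.
rewrite mnmDE !mnm1E; case: (x =P z) => [<-|_]; last by case: (y =P z) => [<-|_].
by rewrite eq_sym nxy addn0.
Qed.

(** Uncrossing one pair at a time terminates, as the total length decreases.
    Modulo the Plücker ideal every monomial becomes a non-crossing one of the
    same weight plus heavier non-crossing ones; modulo the quartet forms the
    heavier terms disappear. *)
Lemma normal_form m : exists p : 'X_{1..N} * S,
  [/\ [/\ noncross p.1, wt p.1 = wt m & same_crossings p.1 m],
      K ('X_[m] - 'X_[p.1]), I ('X_[m] - 'X_[p.1] - p.2) &
      forall m', m' \in msupp p.2 -> noncross m' /\ wt m < wt m'].
Proof.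
have [c] := ubnP (msum (@arc_length n) m); elim: c m => // c IH m; rewrite ltnS => hm.
have [nc|] := boolP (noncross m).
  exists (m, 0); split=> //=; rewrite ?subrr ?subr0; try exact: ideal_gen0.
  by move=> m'; rewrite -[0]mpolyC0 msupp0.
case/crossing_factor=> i [j [k [l [r [s em]]]]].
have [mg [mo [[eg lto cr ncg] leng leno Irel ini]]] := quartet_relation s.
have [|[mg' hg] /= [[ncg' wtg' crg'] Kg Ig suppg]] := IH (mg + r)%MM.
  by move: hm leng; rewrite em !msumD; lia.
have [|[mo' ho] /= [[nco' wto' cro'] Ko Io suppo]] := IH (mo + r)%MM.
  by move: hm leno; rewrite em !msumD; lia.
have wtD m1 m3 : wt (m1 + m3)%MM = wt m1 + wt m3 by apply: mnm_weightD.
have wtm : wt (mg + r)%MM = wt m.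
  by rewrite em (wtD mg r) (wtD (mcross i j k l) r) eg.
have wtm' : wt m < wt (mo + r)%MM 
  by rewrite em (wtD mo r) (wtD (mcross i j k l) r) ltrD2r.
exists (mg', hg + 'X_[mo'] + ho); split=> /=.
- split=> //; first by rewrite wtg'.
  by move=> a b ab; rewrite crg' // em (same_crossingsD r cr).
- have -> : 'X_[m] - 'X_[mg'] = 'X_[r] * ('X_[mcross i j k l] - 'X_[mg]) +
      ('X_[mg + r] - 'X_[mg']) :> S by rewrite em !mpolyXD; ring.
  apply: ideal_genD => //; apply: ideal_genM; rewrite -opprB.
  by apply: ideal_genN; apply: ideal_gen_mem; exists i, j, k, l.
- have -> : 'X_[m] - 'X_[mg'] - (hg + 'X_[mo'] + ho) =
     'X_[r] * ('X_[mcross i j k l] - 'X_[mg] - 'X_[mo]) +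
     ('X_[mg + r] - 'X_[mg'] - hg) + ('X_[mo + r] - 'X_[mo'] - ho) :> S.
    by rewrite em !mpolyXD; ring.
  by apply: ideal_genD => //; apply: ideal_genD => //; apply: ideal_genM.
move=> m' /msuppD_le; rewrite mem_cat => /orP[/msuppD_le|/suppo[nc' lt']].
  rewrite mem_cat => /orP[/suppg[nc' lt']|]; first by rewrite -wtm.
  by rewrite msuppX inE => /eqP->; rewrite wto'.
by split=> //; apply: lt_trans lt'.
Qed.

(** Rewrite every monomial of [f] in normal form.  The result is a combination of
    non-crossing monomials in the Plücker ideal, hence zero.  Its part of least
    weight is the normal form of the initial form of [f] modulo the quartet
    forms, since the correction terms are heavier. *)
Lemma initial_form_in f : I f -> K (initial_form w f).
Proof.
move=> If; have [nf nfP] := choice normal_form.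
pose Nf m := (nf m).1; pose H m := (nf m).2.
pose F : S := \sum_(m <- msupp f) f@_m *: ('X_[Nf m] + H m).
have F0 : F = 0.
  apply: (noncross_independent n2) => [|m].
    have -> : F = f - \sum_(m <- msupp f) (f@_m)%:MP * ('X_[m] - 'X_[Nf m] - H m).
      rewrite [X in X - _]mpolyE -sumrB; apply: eq_bigr => m _.
      by rewrite mul_mpolyC -scalerBr; congr (_ *: _); ring.
    apply: ideal_genB => //; apply: ideal_gen_sum => m _.
    by apply: ideal_genM; case: (nfP m).
  move=> /msupp_sum_le/flattenP[s /mapP[m1 _ ->]] /msuppZ_le /msuppD_le.
  have [[nc _ _] _ _ h] := nfP m1.
  by rewrite mem_cat msuppX inE => /orP[/eqP->|/h[]].
pose P m := all (fun m' => wt m <= wt m') (msupp f).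
have -> : initial_form w f =
    \sum_(m <- msupp f | P m) (f@_m)%:MP * ('X_[m] - 'X_[Nf m]) +
    \sum_(m <- msupp f | P m) f@_m *: 'X_[Nf m].
  rewrite -big_split; apply: eq_bigr => m _ /=.
  by rewrite mul_mpolyC -scalerDr subrK.
have -> : \sum_(m <- msupp f | P m) f@_m *: 'X_[Nf m] = 0.
  apply/mpolyP => m1; rewrite mcoeff0 raddf_sum /=.
  have [/hasP[m2 m2f /andP[Pm2 /eqP e2]]|/hasPn h] :=
      boolP (has (fun m => P m && (Nf m == m1)) (msupp f)); last first.
    rewrite big_seq_cond big1 // => m /andP[mf Pm]; rewrite mcoeffZ mcoeffX.
    by have := h m mf; rewrite Pm /= => /negPf->; rewrite mulr0.
  transitivity (F@_m1); last by rewrite F0 mcoeff0.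
  rewrite [RHS]raddf_sum /=.
  have wm1 : wt m1 = wt m2 by rewrite -e2; case: (nfP m2) => -[].
  rewrite [RHS](bigID P) /= [X in _ = _ + X]big_seq_cond [X in _ = _ + X]big1.
    rewrite addr0 !(big_seq_cond P); apply: eq_bigr => m /andP[mf Pm].
    rewrite !mcoeffZ mcoeffD [(H m)@_m1]memN_msupp_eq0 ?addr0 //.
    have [_ _ _ h] := nfP m; apply/negP => /h[_].
    by rewrite wm1 ltNge (allP Pm2).
  move=> m /andP[mf /allPn[m' m'f]]; rewrite -ltNge => lt.
  have lt1 : wt m1 < wt m.
    by rewrite wm1; apply: le_lt_trans lt; apply: (allP Pm2).
  have [[_ e _] _ _ h] := nfP m.
  rewrite mcoeffZ mcoeffD mcoeffX [(H m)@_m1]memN_msupp_eq0; last first.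
    by apply/negP => /h[_]; rewrite ltNge (ltW lt1).
  case: eqP => [e1|_]; last by rewrite addr0 mulr0.
  by move: lt1; rewrite -e1 e ltxx.
rewrite addr0 -big_filter; apply: ideal_gen_sum => m _.
by apply: ideal_genM; case: (nfP m).
Qed.

Lemma initial_ideal_quartets : initial_ideal w I = K.
Proof.
apply/seteqP; split=> f; apply: ideal_gen_sub => g.
  by case=> h Ih <-; apply: initial_form_in.
case=> i [j [k [l [s ->]]]]; apply: ideal_gen_mem.
exists (plucker_rel R i j k l) => //; apply: ideal_gen_mem.
exists i, j, k, l; split=> //.
by have [ij jk kl _] := sorted4_lt s; rewrite /cw4 ij jk kl.
Qed.

(** * The toric parametrization *)

Local Notation M := #|{: 'I_n * 'I_n}|.
Local Notation Q := {mpoly R[i][M]}.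

Definition crossing_mnm_of m : 'X_{1..M} :=
  [multinom (let ab := enum_val c in
     if E ab.1 ab.2 then msum (chi ab.1 ab.2) m else 0%N) | c < M].

Definition crossing_map : S -> Q :=
  mmap (@mpolyC M R[i]) (fun x => 'X_[crossing_mnm_of U_(x)%MM]).

HB.instance Definition _ := GRing.RMorphism.on crossing_map.

Lemma crossing_mapX m : crossing_map 'X_[m] = 'X_[crossing_mnm_of m].
Proof.
rewrite /crossing_map mmapX /mmap1 mprodXnE; congr 'X_[_].
apply/mnmP => c; rewrite mnm_sumE mnmE /=.
case h: (E (enum_val c).1 (enum_val c).2).
  by apply: eq_bigr => x _; rewrite mulmnE mnmE /= h msumU mulnC.
by rewrite big1 // => x _; rewrite mulmnE mnmE /= h mul0n.
Qed.

Lemma crossing_mnm_ofP m m' :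
  crossing_mnm_of m = crossing_mnm_of m' <-> same_crossings m m'.
Proof.
split=> [e a b ab|h].
  have := congr1 (fun c : 'X_{1..M} => c (enum_rank (a, b))) e.
  by rewrite !mnmE /= enum_rankK /= ab.
by apply/mnmP => c; rewrite !mnmE /=; case: ifP => // /h.
Qed.

Lemma crossing_map_quartets f : K f -> crossing_map f = 0.
Proof.
apply: (ideal_gen_min (J := fun g => crossing_map g = 0)) => [||a g h|g].
- by rewrite raddf0.
- by move=> g h g0 h0; rewrite rmorphD /= g0 h0 addr0.
- by rewrite rmorphM /= h mulr0.
case=> i [j [k [l [s ->]]]].
have [mg [mo [[_ _ cr _] _ _ _ ->]]] := quartet_relation s.
by rewrite rmorphB /= !crossing_mapX (proj2 (crossing_mnm_ofP _ _) cr) subrr.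
Qed.

Lemma mcoeff_crossing_map f c : (crossing_map f)@_c =
  \sum_(m <- msupp f) f@_m * (crossing_mnm_of m == c)%:R.
Proof.
rewrite {1}[f]mpolyE rmorph_sum /= raddf_sum /=; apply: eq_bigr => m _.
by rewrite -mul_mpolyC rmorphM /= crossing_mapX /crossing_map mmapC mul_mpolyC mcoeffZ mcoeffX.
Qed.

(** Modulo the quartet forms [f] is a combination of non-crossing monomials, and
    these have distinct images by rigidity. *)
Lemma crossing_map_ker f : crossing_map f = 0 -> K f.
Proof.
move=> f0; have [nf nfP] := choice normal_form.
pose Nf m := (nf m).1; pose F : S := \sum_(m <- msupp f) f@_m *: 'X_[Nf m].
have KF : K (f - F).
  rewrite {1}[f]mpolyE -sumrB; apply: ideal_gen_sum => m _.
  by rewrite -scalerBr -mul_mpolyC; apply: ideal_genM; case: (nfP m).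
suff F0 : F = 0 by rewrite -[f]subr0 -F0.
have ncF m : m \in msupp F -> noncross m.
  move=> /msupp_sum_le/flattenP[s /mapP[m1 _ ->]] /msuppZ_le.
  by rewrite msuppX inE => /eqP->; case: (nfP m1) => -[].
have mF0 : crossing_map F = 0.
  have := crossing_map_quartets KF; rewrite rmorphB /= f0 sub0r.
  by move/eqP; rewrite oppr_eq0 => /eqP.
apply/mpolyP => m; rewrite mcoeff0.
have [mF|/memN_msupp_eq0 //] := boolP (m \in msupp F).
have := mcoeff_crossing_map F (crossing_mnm_of m); rewrite mF0 mcoeff0.
rewrite (bigD1_seq m mF (msupp_uniq F)) /= eqxx mulr1 big1_seq ?addr0 //.
move=> m' /andP[nm m'F]; case: eqP => [/crossing_mnm_ofP e|_]; last by rewrite mulr0.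
by rewrite (noncross_rigid (ncF _ m'F) (ncF _ mF) e) eqxx in nm.
Qed.

Lemma quartet_ideal_prime : prime_ideal K.
Proof.
have memK f : (f \in mem K) = (crossing_map f == 0).
  apply/idP/eqP => [|h]; first by rewrite inE => /crossing_map_quartets.
  by rewrite inE; apply: crossing_map_ker.
split; first split.
- by rewrite memK raddf0.
- by rewrite memK rmorph1 oner_eq0.
- move=> a u v; rewrite !memK => /eqP u0 /eqP v0.
  by rewrite rmorphD rmorphM /= u0 v0 mulr0 addr0.
by move=> u v; rewrite !memK rmorphM mulf_eq0.
Qed.

(** * Binomial generators *)

(** The degree at a vertex is a crossing number with a boundary edge. *)
Lemma same_crossings_degree m m' v : same_crossings m m' ->
  msum (vdeg v) m = msum (vdeg v) m'.
Proof.
have ab : E (ord_pred v) v.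
  by rewrite -{2}(ord_predK v); apply: (boundary_arc triE); apply: ltnW.
have e m0 : msum (vdeg v) m0 = msum (chi (ord_pred v) v) m0.
  apply: eq_msum => x _; rewrite /vdeg /chi -!val_eqE /=.
  rewrite -[((v + n).-1 %% n)%N]/(nat_of_ord (ord_pred v)) val_ord_pred.
  have := lo_hi x; have := ltn_ord (hi x).
  by case: (v =P 0%N :> nat) => hv; lia.
by move=> h; rewrite !e h.
Qed.

Lemma sum_vdeg m : (\sum_v msum (vdeg v) m = (mdeg m).*2)%N.
Proof.
rewrite -(msum_sum predT) -muln2 mdegE big_distrl; apply: eq_bigr => x _.
rewrite /vdeg big_split /=; congr (_ * _)%N.
have one (p : 'I_n) : (\sum_v (p == v) = 1)%N.
  by rewrite (bigD1 p) //= eqxx big1 ?addn0 // => v; rewrite eq_sym => /negPf->.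
by rewrite !one.
Qed.

(** The two terms have the same crossing numbers.  If the term dividing the
    crossing monomial had degree less than two, both would be non-crossing, hence
    equal; so it is the crossing monomial.  The other term is non-crossing, as
    two crossing pairs with the same end points coincide, and rigidity
    identifies it. *)
Lemma binomial_of_quartet i j k l g al be : sorted4 i j k l ->
  crossing_map g = 0 -> is_binomial g -> be \in msupp g ->
  (al + be)%MM = mcross i j k l ->
  exists2 c, c != 0 & g = c *: initial_form w (plucker_rel R i j k l).
Proof.
move=> s g0 gbin beg albe.
have [mg [mo [[eg lto cr ncg] _ _ _ ->]]] := quartet_relation s.
have [ga [nbg gag supp]] : exists ga, [/\ be != ga, ga \in msupp g &
    msupp g =i [:: be; ga]].
  move: gbin beg (msupp_uniq g); rewrite /is_binomial.
  case: (msupp g) => [|x [|y [|]]] //= _; rewrite !inE andbT => bexy nxy.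
  case/orP: bexy => /eqP->; [exists y|exists x]; split=> //.
  - by rewrite !inE eqxx orbT.
  - by rewrite eq_sym.
  - by rewrite !inE eqxx.
  by move=> z; rewrite !inE orbC.
have eg2 : g = g@_be *: 'X_[be] + g@_ga *: 'X_[ga].
  have pe : perm_eq (msupp g) [:: be; ga].
    by apply: uniq_perm; rewrite ?msupp_uniq //= inE nbg.
  by rewrite {1}[g]mpolyE (perm_big _ pe) /= big_cons big_seq1.
have cbe : g@_be != 0 by rewrite -mcoeff_msupp.
have [eA ec] : same_crossings be ga /\ g@_ga = - g@_be.
  have e : crossing_map g = g@_be *: 'X_[crossing_mnm_of be] + g@_ga *: 'X_[crossing_mnm_of ga].
    rewrite {1}eg2 rmorphD /= -!mul_mpolyC !rmorphM /= !crossing_mapX.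
    by rewrite /crossing_map !mmapC.
  have := congr1 (mcoeff (crossing_mnm_of be)) e.
  rewrite g0 mcoeff0 mcoeffD !mcoeffZ !mcoeffX eqxx mulr1.
  case: eqP => [eA|_]; last by rewrite mulr0 addr0 => /esym/eqP; rewrite (negPf cbe).
  by move/esym/eqP; rewrite mulr1 addrC addr_eq0 => /eqP; split=> //; apply/crossing_mnm_ofP.
have edeg : mdeg be = mdeg ga.
  apply: double_inj; rewrite -!sum_vdeg; apply: eq_bigr => v _.
  exact: same_crossings_degree.
have deg2 : mdeg be = 2%N.
  apply/eqP; rewrite eqn_leq; apply/andP; split.
    have := congr1 mdeg albe; rewrite !mdegD.
    have [ij jk kl [ik jl _]] := sorted4_lt s.
    have [x [-> _ _]] := pmonP ik; have [y [-> _ _]] := pmonP jl.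
    by rewrite !mdeg1 => e; apply: (leq_trans (leq_addl (mdeg al) _)); rewrite e.
  rewrite leqNgt; apply/negP => lt2; move/eqP: nbg; apply.
  by apply: noncross_rigid => //; apply: noncross_small; rewrite -?edeg.
have ebe : be = mcross i j k l.
  have := congr1 mdeg albe; rewrite !mdegD deg2.
  have [ij jk kl [ik jl _]] := sorted4_lt s.
  have [x [ex _ _]] := pmonP ik; have [y [ey _ _]] := pmonP jl.
  rewrite {1}ex {1}ey !mdeg1 => e; rewrite -albe.
  have : mdeg al == 0%N by move: e; clear; lia.
  by rewrite mdeg_eq0 => /eqP->; rewrite add0m.
have ega : ga = mg.
  have cr' : same_crossings ga mg by move=> a b ab; rewrite -eA // ebe cr.
  apply: noncross_rigid => //; apply: contraT => /crossing_factor.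
  case=> i' [j' [k' [l' [r [s' e']]]]].
  have r0 : r = 0%MM.
    have := congr1 mdeg e'; rewrite -edeg deg2 !mdegD.
    have [ij jk kl [ik jl _]] := sorted4_lt s'.
    have [x [-> _ _]] := pmonP ik; have [y [-> _ _]] := pmonP jl.
    rewrite !mdeg1 => e; apply/eqP; rewrite -mdeg_eq0.
    by move: e; clear; lia.
  rewrite r0 addm0 in e'.
  have [v|? ? ? ?] := cross_endpoints s s'.
    by rewrite -e' -ebe; apply: same_crossings_degree.
  by subst i' j' k' l'; rewrite ebe e' eqxx in nbg.
exists (- g@_be); first by rewrite oppr_eq0.
rewrite {1}eg2 ec ebe ega.
by rewrite scalerBr !scaleNr opprK addrC.
Qed.

Lemma quartet_form_binomial g : quartet_forms g -> is_binomial g.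
Proof.
case=> i [j [k [l [s ->]]]].
have [mg [mo [[_ _ _ ncg] _ _ _ ->]]] := quartet_relation s.
apply: binomial_supp.
by apply: contraTneq ncg => ->; apply: cross_not_noncross.
Qed.

Lemma quartet_form_coeff i j k l : sorted4 i j k l ->
  (initial_form w (plucker_rel R i j k l))@_(mcross i j k l) = -1.
Proof.
move=> s; have [mg [mo [[_ _ _ ncg] _ _ _ ->]]] := quartet_relation s.
rewrite mcoeffB !mcoeffX eqxx; case: eqP => [e|_]; last by rewrite sub0r.
by move: ncg; rewrite e (negPf (cross_not_noncross s)).
Qed.

(** Write the form as a combination of generators: the coefficient of the
    crossing monomial comes from a generator with a term that divides it. *)
Lemma quartet_form_in_generators (G : set S) i j k l : sorted4 i j k l ->
  ideal_gen G = K -> (forall g, G g -> is_binomial g) ->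
  exists2 g, G g & exists2 c, c != 0 & g = c *: initial_form w (plucker_rel R i j k l).
Proof.
move=> s GK Gbin.
have inG : ideal_gen G (initial_form w (plucker_rel R i j k l)).
  by rewrite GK; apply: ideal_gen_mem; exists i, j, k, l.
have [|g [al [be [Gg beg e]]]] := ideal_gen_coeff (m := mcross i j k l) inG.
  by rewrite quartet_form_coeff // oppr_eq0 oner_eq0.
exists g => //; apply: (binomial_of_quartet s _ _ beg e); last exact: Gbin.
by apply: crossing_map_quartets; rewrite -GK; apply: ideal_gen_mem.
Qed.

Lemma crossing_mnmE i j k l : sorted4 i j k l ->
  crossing_mnm R i j k l = mcross i j k l.
Proof.
move=> s; have [ij jk kl [ik jl _]] := sorted4_lt s.
by rewrite /crossing_mnm !plucker_coordX // -mpolyXD mleadXm.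
Qed.

(** A generating set of quartet forms contains each of them up to a factor, and
    two quartet forms with a common crossing monomial are equal. *)
Lemma quartet_forms_minimal : minimal_generating_set K quartet_forms.
Proof.
split=> // G sub GK; apply/seteqP; split=> // f [i [j [k [l [s ->]]]]].
have [|g Gg [c c0 eg]] := quartet_form_in_generators s GK.
  by move=> g /sub/quartet_form_binomial.
have [i' [j' [k' [l' [s' eg']]]]] := sub _ Gg.
have [mg [mo [[_ _ _ ncg] _ _ _ e]]] := quartet_relation s.
have [mg' [mo' [[_ _ _ ncg'] _ _ _ e']]] := quartet_relation s'.
have ee : mcross i j k l = mcross i' j' k' l'.
  have : g@_(mcross i j k l) != 0.
    by rewrite eg mcoeffZ quartet_form_coeff // mulrN1 oppr_eq0.
  rewrite eg' e' mcoeffB !mcoeffX.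
  have [e1|_] := eqVneq mg' (mcross i j k l).
    by move: ncg'; rewrite e1 (negPf (cross_not_noncross s)).
  by have [-> //|_] := eqVneq (mcross i' j' k' l') (mcross i j k l); rewrite subrr eqxx.
have [v|? ? ? ?] := cross_endpoints s s'; first by rewrite ee.
by subst i' j' k' l'; rewrite -eg'.
Qed.

(** The generators that are multiples of quartet forms generate already. *)
Lemma minimal_generator_quartet (G : set S) g : minimal_generating_set K G ->
  (forall g, G g -> is_binomial g) -> G g ->
  exists i j k l, sorted4 i j k l /\
    exists2 c, c != 0 & g = c *: initial_form w (plucker_rel R i j k l).
Proof.
case=> GK Gmin Gbin Gg.
pose G' : set S := [set h | G h /\ exists i j k l, sorted4 i j k l /\
    exists2 c, c != 0 & h = c *: initial_form w (plucker_rel R i j k l)]%classic.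
suff e : G' = G by move: Gg; rewrite -e => -[].
apply: Gmin; first by move=> h [].
apply/seteqP; split=> f.
  by rewrite -GK; apply: ideal_gen_sub => h [Gh _]; apply: ideal_gen_mem.
apply: ideal_gen_sub => _ [i [j [k [l [s ->]]]]].
have [h Gh [c c0 eh]] := quartet_form_in_generators s GK Gbin.
have -> : initial_form w (plucker_rel R i j k l) = c^-1%:MP * h.
  by rewrite mul_mpolyC eh scalerA mulVf // scale1r.
apply: ideal_genM; apply: ideal_gen_mem; split=> //.
by exists i, j, k, l; split=> //; exists c.
Qed.

End Main.

Theorem proposition4p36 (R : realType) (n : nat) (hn : (3 <= n)%N)
    (T : {set {set 'I_n}}) (hT : triangulation T)
    (wT : {linear arc_space R T -> R^o}) (hw : quadrilateral_weight_map wT) :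
  let w := weight_vector wT in
  let J := initial_ideal w (plucker_ideal R n) in
  [/\ toric_ideal J,
      exists2 G : set (plucker_ring R n),
        minimal_generating_set J G & (forall g, G g -> is_binomial g) &
      forall G : set (plucker_ring R n),
        minimal_generating_set J G -> (forall g, G g -> is_binomial g) ->
        forall g, G g ->
        exists i j k l : 'I_n,
          [/\ cw4 i j k l,
              exists2 c : R[i], c != 0 &
                g = c *: initial_form w (plucker_rel R i j k l) &
              crossing_mnm R i j k l \in msupp g]].
Proof.
move=> w J; rewrite /J /w (initial_ideal_quartets hn hT hw).
split.
- split; last exact: (quartet_ideal_prime hn hT hw).
  exists (quartet_forms wT) => // g; exact: (quartet_form_binomial hn hT hw).
- exists (quartet_forms wT); first exact: (quartet_forms_minimal hn hT hw).
  by move=> g; apply: (quartet_form_binomial hn hT hw).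
move=> G Gmin Gbin g Gg.
have [i [j [k [l [s [c c0 eg]]]]]] := minimal_generator_quartet hn hT hw Gmin Gbin Gg.
exists i, j, k, l; split.
- by have [ij jk kl _] := sorted4_lt s; rewrite /cw4 ij jk kl.
- by exists c.
rewrite crossing_mnmE // mcoeff_msupp eg mcoeffZ (quartet_form_coeff hn hT hw s).
by rewrite mulrN1 oppr_eq0.
Qed.
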